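(* Let $V$ be a finite set and $a\in[0,1)$. The function $P:\mathcal{F}_{a,V}\times[0,1]^V\to\mathbb{N}\cup\{\infty\}$ which assigns to $(F_{\mathcal{G},\sigma,T,a},\mathbf{x})$ the asymptotic $F_{\mathcal{G},\sigma,T,a}$-period of $\mathbf{x}$ is measurable. Furthermore, for each probability distribution $\mathbb{P}_G$ on $\mathfrak{G}_V$ and each $\eta\in[0,1]$, $$\mathbb{P}_{a,\eta}\left\{(F_{\mathcal{G},\sigma,T,a},\mathbf{x})\in\mathcal{F}_{a,V}\times[0,1]^V:\ P(F_{\mathcal{G},\sigma,T,a},\mathbf{x})<\infty\right\}=1.$$
   Context: Let $V$ be a finite set. $\mathfrak{G}_V:=\{(V,A): A\subset V\times V\}$ is the set of all directed graphs with vertex set $V$ (loops allowed). For $\mathcal{G}=(V,A)\in\mathfrak{G}_V$, $\sigma\in\{-1,1\}^A$, $T\in[0,1]^A$ and $a\in[0,1)$, define $F_{\mathcal{G},\sigma,T,a}:[0,1]^V\to[0,1]^V$ by $$F_{\mathcal{G},\sigma,T,a}(\mathbf{x}):=a\mathbf{x}+(1-a)D_{\mathcal{G},\sigma,T}(\mathbf{x}),\qquad D_{\mathcal{G},\sigma,T}(\mathbf{x})_v:=\frac{1}{\mathrm{Id}(v)}\sum_{u\in V:(u,v)\in A}H\big(\sigma_{(u,v)}(\mathbf{x}_u-T_{(u,v)})\big),$$ where $\mathrm{Id}(v):=\#\{u\in V:(u,v)\in A\}$ (with $D_{\mathcal{G},\sigma,T}(\mathbf{x})_v:=0$ if $\mathrm{Id}(v)=0$)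 and $H:\mathbb{R}\to\{0,1\}$ is the Heaviside function: $H(s)=0$ for $s<0$, $H(s)=1$ for $s>0$, and $H(0)\in\{0,1\}$ a fixed convention. $\mathcal{F}_{a,V}:=\{F_{\mathcal{G},\sigma,T,a}:\mathcal{G}=(V,A)\in\mathfrak{G}_V,\ \sigma\in\{-1,1\}^A,\ T\in[0,1]^A\}$, whose elements are regarded as indexed by the triples $(\mathcal{G},\sigma,T)$. The sample space $\mathcal{F}_{a,V}\times[0,1]^V$ carries the product sigma-algebra, with Borel sigma-algebras on $[0,1]^V$ and on each $[0,1]^A$ (and all subsets for the finitely many pairs $(\mathcal{G},\sigma)$). Given a probability distribution $\mathbb{P}_G$ on the finite set $\mathfrak{G}_V$ and $\eta\in[0,1]$, the probability measure $\mathbb{P}_{a,\eta}$ on $\mathcal{F}_{a,V}\times[0,1]^V$ is the one satisfying, for each $\mathcal{G}=(V,A)$, each $\sigma\in\{-1,1\}^A$ and all rectangles $\mathcal{I}\subset[0,1]^A$, $\mathcal{J}\subset[0,1]^V$, $$\mathbb{P}_{a,\eta}\{(F_{\mathcal{G},\sigma,T,a},\mathbf{x}):T\in\mathcal{I},\mathbf{x}\in\mathcal{J}\}=\mathbb{P}_G(\mathcal{G})\,\mathbb{P}_{A,\eta}(\sigma)\,\mathrm{vol}(\mathcal{I})\,\mathrm{vol}(\mathcal{J}),$$ where $\mathrm{vol}$ is Lebesgue measure and $\mathbb{P}_{A,\eta}(\sigma)=\prod_{(u,v)\in A}\left(\frac{\sigma_{(u,v)}+1}{2}-\sigma_{(u,v)}\eta\right)$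 (each sign is independently $-1$ with probability $\eta$ and $+1$ with probability $1-\eta$). For an integer $\tau\geq1$, $\mathrm{Per}_\tau(F)$ is the set of $\mathbf{x}\in[0,1]^V$ with $F^\tau(\mathbf{x})=\mathbf{x}$ and $F^t(\mathbf{x})\neq\mathbf{x}$ for $1\le t<\tau$. The asymptotic $F$-period of $\mathbf{x}$ is $\tau$, written $P(F,\mathbf{x})=\tau$, if there exists $\mathbf{y}\in\mathrm{Per}_\tau(F)$ with $\lim_{t\to\infty}|F^t(\mathbf{x})-F^t(\mathbf{y})|=0$; if there is no such $\tau$, then $P(F,\mathbf{x})=\infty$. *)

(* Defs.v *)
From HB Require Import structures.
From mathcomp Require Import all_boot all_order all_algebra.
From mathcomp Require Import all_classical all_reals all_analysis.
From mathcomp Require Import measurable_realfun lra ring.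

Set Implicit Arguments.
Unset Strict Implicit.
Unset Printing Implicit Defensive.

Import Order.TTheory GRing.Theory Num.Theory.
Import numFieldNormedType.Exports.

Local Open Scope classical_set_scope.
Local Open Scope ring_scope.

Record cube (R : realType) (I : finType) := Cube {
  cube_val :> I -> R ;
  cube_itv : forall i, 0 <= cube_val i <= 1 }.

Section cube_structure.
Context (R : realType) (I : finType).

HB.instance Definition _ := gen_eqMixin (cube R I).
HB.instance Definition _ := gen_choiceMixin (cube R I).

Fact cube0_itv (i : I) : 0 <= (0 : R) <= 1.
Proof. by rewrite lexx ler01. Qed.

HB.instance Definition _ := isPointed.Build (cube R I) (Cube cube0_itv).

HB.instance Definition _ := Topological.copy (cube R I)
  (initial_topology (@cube_val R I : cube R I -> prod_topology (fun=> R))).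

HB.instance Definition _ := @isMeasurable.Build default_measure_display
  (cube R I) <<s @open (cube R I) >> (@sigma_algebra0 _ setT open)
  (@sigma_algebraC _ open) (@sigma_algebra_bigcup _ setT open).

Lemma cube_val_inj : injective (@cube_val R I).
Proof.
move=> [x px] [y py] /= exy; move: px py; rewrite exy => px py.
by congr Cube; exact: Prop_irrelevance.
Qed.

(* Rectangles are products of intervals of any kind, open, closed or empty. *)
Definition box (J : I -> interval R) : set (cube R I) :=
  [set x | forall i, x i \in J i].

Definition box_vol (J : I -> interval R) : \bar R :=
  (\prod_i lebesgue_measure [set` J i])%E.

Definition edist (x y : cube R I) : R :=
  Num.sqrt (\sum_i (x i - y i) ^+ 2).

End cube_structure.

Definition arcs (V : finType) (A : {set V * V}) : finType :=
  {e : V * V | e \in A}.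

(* The boolean b encodes the sign (-1) ^+ b. *)
Definition signs (V : finType) (A : {set V * V}) := {ffun arcs A -> bool}.

(* The index (G, sigma, T) of a map of the family; a graph on V is given by its
   set of arcs, so that loops are allowed. *)
Record network (R : realType) (V : finType) := Network {
  net_arcs : {set V * V} ;
  net_sign : signs net_arcs ;
  net_thr : cube R (arcs net_arcs) }.

Section network_structure.
Context (R : realType) (V : finType).

HB.instance Definition _ := gen_eqMixin (network R V).
HB.instance Definition _ := gen_choiceMixin (network R V).
HB.instance Definition _ := isPointed.Build (network R V)
  (@Network R V finset.set0 [ffun=> false] point).

(* The sigma-algebra of the disjoint union, over the finitely many pairs
   (A, s), of the cubes [0, 1]^A with their Borel sets. *)
Definition network_measurable : set (set (network R V)) :=
  [set S | forall (A : {set V * V}) (s : signs A),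
    measurable (@Network R V A s @^-1` S)].

Let network0 : network_measurable set0.
Proof. by move=> A s; rewrite preimage_set0; exact: measurable0. Qed.

Let networkC S : network_measurable S -> network_measurable (~` S).
Proof. by move=> mS A s; rewrite preimage_setC; apply: measurableC; exact: mS. Qed.

Let network_bigcup (S : (set (network R V))^nat) :
  (forall n, network_measurable (S n)) -> network_measurable (\bigcup_n S n).
Proof.
move=> mS A s; rewrite preimage_bigcup.
by apply: bigcupT_measurable => n; exact: mS.
Qed.

HB.instance Definition _ := @isMeasurable.Build default_measure_display
  (network R V) network_measurable network0 networkC network_bigcup.

End network_structure.

Section network_map.
Context (R : realType) (V : finType).
(* H0 is the value of the Heaviside function at 0. *)
Variables (H0 : bool) (a : R).

Definition heaviside (s : R) : R :=
  if s < 0 then 0 else if 0 < s then 1 else H0%:R.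

Definition indeg (A : {set V * V}) (v : V) : nat := #|[set u | (u, v) \in A]|%SET.

(* As 0^-1 = 0, this is 0 at the vertices without incoming arcs. *)
Definition net_drive (N : network R V) (x : V -> R) (v : V) : R :=
  (indeg (net_arcs N) v)%:R^-1 *
  \sum_(e : arcs (net_arcs N) | (val e).2 == v)
     heaviside ((-1) ^+ net_sign N e * (x (val e).1 - net_thr N e)).

Hypothesis ha : 0 <= a < 1.

Lemma net_drive_itv (N : network R V) (x : V -> R) (v : V) :
  0 <= net_drive N x v <= 1.
Proof.
have H01 (t : R) : 0 <= heaviside t <= 1.
  rewrite /heaviside; case: ifP => _; first by rewrite lexx ler01.
  case: ifP => _; first by rewrite lexx ler01.
  by case: H0; rewrite lexx ler01.
have H_ge0 t : 0 <= heaviside t by case/andP: (H01 t).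
have H_le1 t : heaviside t <= 1 by case/andP: (H01 t).
rewrite /net_drive; set S := \sum_(e | _) _.
have S0 : 0 <= S by apply: sumr_ge0.
have Sle : S <= (indeg (net_arcs N) v)%:R.
  apply: (@le_trans _ _ (\sum_(e : arcs (net_arcs N) | (val e).2 == v) 1)).
    exact: ler_sum.
  rewrite sumr_const ler_nat -(card_in_image (f := fun e => (val e).1)).
    apply/subset_leq_card/fintype.subsetP => u /fintype.imageP[e].
    by rewrite !inE => /eqP <- ->; rewrite -surjective_pairing; exact: valP.
  move=> [[u1 v1] p1] [[u2 v2] p2] /eqP /= v1E /eqP /= v2E /= u12.
  by apply: val_inj => /=; rewrite u12 v1E v2E.
rewrite mulr_ge0 ?invr_ge0//=.
case: (posnP (indeg (net_arcs N) v)) => [->|d0]; first by rewrite invr0 mul0r.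
by rewrite mulrC ler_pdivrMr ?ltr0n// mul1r.
Qed.

Lemma network_map_itv (N : network R V) (x : cube R V) (v : V) :
  0 <= a * x v + (1 - a) * net_drive N x v <= 1.
Proof.
have := net_drive_itv N x v; have := cube_itv x v; move: ha; nra.
Qed.

Definition network_map (N : network R V) (x : cube R V) : cube R V :=
  Cube (network_map_itv N x).

End network_map.

Section asymptotic_period.
Context (R : realType) (V : finType).
Implicit Types (F : cube R V -> cube R V) (x y : cube R V).

Definition Per (tau : nat) F : set (cube R V) :=
  [set x | iter tau F x = x /\
           forall t, (1 <= t < tau)%N -> iter t F x <> x].

Definition has_asymptotic_period F x (tau : nat) : Prop :=
  (1 <= tau)%N /\ exists2 y, Per tau F y &
    (fun t => edist (iter t F x) (iter t F y)) @ \oo --> (0 : R).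

Lemma ler_edist (x y : cube R V) (v : V) : `|x v - y v| <= edist x y.
Proof.
rewrite -sqrtr_sqr /edist ler_wsqrtr// (bigD1 v)//= lerDl.
by apply: sumr_ge0 => i _; exact: sqr_ge0.
Qed.

Lemma has_asymptotic_period_uniq F x (tau1 tau2 : nat) :
  has_asymptotic_period F x tau1 -> has_asymptotic_period F x tau2 ->
  tau1 = tau2.
Proof.
move=> [tau1_gt0 [y1 [y1P y1min] /cvgr0_norm_lt xy1]].
move=> [tau2_gt0 [y2 [y2P y2min] /cvgr0_norm_lt xy2]].
have y12 : y1 = y2.
  apply/cube_val_inj/funext => v; apply: contrapT => /eqP; rewrite -subr_eq0.
  rewrite -normr_gt0 => e0; have e20 := divr_gt0 e0 (ltr0Sn R 1).
  have [n _ nP] := filterI (xy1 _ e20) (xy2 _ e20).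
  have /nP[/=] : (n <= n * (tau1 * tau2))%N.
    by rewrite leq_pmulr// muln_gt0 tau1_gt0.
  set t := (n * _)%N.
  have -> : iter t F y1 = y1.
    by rewrite /t mulnCA mulnC iterM iter_fix.
  have -> : iter t F y2 = y2 by rewrite /t mulnA iterM iter_fix.
  move=> /(le_lt_trans (ler_norm _)) /(le_lt_trans (ler_edist _ _ v)).
  move=> h1 /(le_lt_trans (ler_norm _)) /(le_lt_trans (ler_edist _ _ v)) h2.
  suff : `|y1 v - y2 v| < `|y1 v - y2 v| by rewrite ltxx.
  set z := iter t F x v in h1 h2.
  rewrite [X in X < _](_ : _ = `|(z - y2 v) - (z - y1 v)|); last first.
    by congr (`|_|); ring.
  apply: le_lt_trans (ler_normB _ _) _.
  by rewrite [ltRHS]splitr addrC ltrD.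
rewrite {}y12 in y1P y1min.
have [lt12|lt21|//] := ltngtP tau1 tau2.
- by have := y2min tau1; rewrite tau1_gt0 lt12 => /(_ isT).
- by have := y1min tau2; rewrite tau2_gt0 lt21 => /(_ isT).
Qed.

End asymptotic_period.

(* N \cup {oo}, None standing for oo, with the discrete sigma-algebra. *)
Definition natinfty := option nat.
HB.instance Definition _ := Choice.on natinfty.
HB.instance Definition _ := isPointed.Build natinfty None.
HB.instance Definition _ := @isMeasurable.Build default_measure_display
  natinfty discrete_measurable discrete_measurable0
  discrete_measurableC discrete_measurableU.

(* The choice of tau is immaterial by has_asymptotic_period_uniq. *)
Definition asymptotic_period (R : realType) (V : finType)
    (F : cube R V -> cube R V) (x : cube R V) : natinfty :=
  if pselect (exists tau, has_asymptotic_period F x tau) is left h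
  then Some (projT1 (cid h)) else None.

Lemma asymptotic_periodP (R : realType) (V : finType)
    (F : cube R V -> cube R V) (x : cube R V) (tau : nat) :
  asymptotic_period F x = Some tau <-> has_asymptotic_period F x tau.
Proof.
rewrite /asymptotic_period; case: pselect => [h|nh].
  have hP := projT2 (cid h); split=> [[<-]//|tauP].
  by congr Some; exact: has_asymptotic_period_uniq hP tauP.
by split=> // tauP; case: nh; exists tau.
Qed.

Definition sign_prob (R : realType) (V : finType) (A : {set V * V}) (eta : R)
    (s : signs A) : R :=
  \prod_(e : arcs A) (((-1) ^+ s e + 1) / 2 - (-1) ^+ s e * eta).

(* The defining property of the law of (F, x), on the triples indexing the maps
   and the initial conditions; such a law exists by network_law_exists. *)
Definition is_network_law (R : realType) (V : finType)
    (PG : {set V * V} -> R) (eta : R)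
    (P : probability (network R V * cube R V)%type R) : Prop :=
  forall (A : {set V * V}) (s : signs A)
    (I : arcs A -> interval R) (J : V -> interval R),
    (forall e, [set` I e] `<=` `[0, 1]) -> (forall v, [set` J v] `<=` `[0, 1]) ->
    P [set (Network s T, x) | T in box I & x in box J] =
    ((PG A * sign_prob eta s)%:E * box_vol I * box_vol J)%E.

Section cube_theory.
Context (R : realType) (I : finType).

Lemma nbhs_cube (x : cube R I) (U : set (cube R I)) : nbhs x U ->
  exists2 e : R, 0 < e &
    forall y : cube R I, (forall i, `|x i - y i| < e) -> U y.
Proof.
case=> B [[C oC <-] Cx CU].
pose G := filter_from [set e : R | 0 < e]
  (fun e => [set y : I -> R | forall i, `|x i - y i| < e]).
have FG : Filter G.
  apply: filter_from_filter; first by exists 1 => /=; exact: ltr01.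
  move=> e1 e2 /= e10 e20; exists (Num.min e1 e2); first by rewrite /= lt_min e10.
  by move=> y /= yP; split=> i; have := yP i; rewrite lt_min => /andP[].
have Gx : G --> (cube_val x : prod_topology (fun=> R)).
  apply/cvg_sup => i W [_ [[D oD <-] Dx] DW].
  have /nbhs_ballP[e e0 eD] : nbhs (x i) D by exact: open_nbhs_nbhs.
  by exists e => // y yP; apply: DW; apply: eD; exact: yP.
have [e e0 eC] : G C by apply: Gx; exact: open_nbhs_nbhs.
by exists e => // y yP; apply: CU; exact: eC.
Qed.

Lemma continuous_cube_coord (i : I) : continuous (fun x : cube R I => x i).
Proof.
move=> x; apply: (@continuous_comp (cube R I) (prod_topology (fun _ : I => R)) R
  (@cube_val R I) (fun y => y i)).
  exact: initial_continuous.
exact: (@proj_continuous I (fun=> R) i).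
Qed.

Lemma measurable_cube_coord (i : I) :
  measurable_fun setT (fun x : cube R I => x i).
Proof.
apply: (measurability _ (RGenOInfty.measurableE R)) => _ [_ [r ->] <-].
rewrite setTI; apply: sub_sigma_algebra.
by move/continuousP: (@continuous_cube_coord i); apply; exact: interval_open.
Qed.


Lemma measurable_coord_itv d (T : measurableType d) (f : T -> I -> R)
    (J : I -> interval R) : (forall i, measurable_fun setT (f ^~ i)) ->
  measurable [set t | forall i, f t i \in J i].
Proof.
move=> mf.
have -> : [set t | forall i, f t i \in J i] =
    \bigcap_i (f ^~ i @^-1` [set` J i]).
  by apply/seteqP; split=> t /= tJ i; [move=> _|]; exact: tJ.
apply: fin_bigcap_measurable; first exact: finite_finset.
by move=> i _; rewrite -[X in measurable X]setTI; apply: mf.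
Qed.

Lemma measurable_box (J : I -> interval R) : measurable (box J).
Proof. by apply: measurable_coord_itv => i; exact: measurable_cube_coord. Qed.

Lemma measurable_fun_cube d (T : measurableType d) (f : T -> cube R I) :
  (forall i, measurable_fun setT (fun t => f t i)) -> measurable_fun setT f.
Proof.
move=> mf; apply: (@measurability _ _ _ _ _ _ (@open (cube R I))) => //.
move=> _ [U oU <-]; rewrite setTI.
pose Q (q : {ffun I -> rat * rat}) i := `](ratr (q i).1 : R), ratr (q i).2[.
pose g q := if pselect (box (Q q) `<=` U) then f @^-1` box (Q q) else set0.
have -> : f @^-1` U = \bigcup_q g q.
  apply/seteqP; split=> [t /= Ut|t [q _]]; last first.
    by rewrite /g; case: pselect => // QU /QU.
  have /nbhs_cube[e e0 eU] : nbhs (f t) U by exact: open_nbhs_nbhs.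
  have e20 := divr_gt0 e0 (ltr0Sn R 1).
  have lt1 i : f t i - e / 2 < f t i by rewrite ltrBlDr ltrDl.
  have lt2 i : f t i < f t i + e / 2 by rewrite ltrDl.
  pose q1 i := xchoose (rat_in_itvoo (lt1 i)).
  pose q2 i := xchoose (rat_in_itvoo (lt2 i)).
  have q1P i := xchooseP (rat_in_itvoo (lt1 i)).
  have q2P i := xchooseP (rat_in_itvoo (lt2 i)).
  exists [ffun i => (q1 i, q2 i)] => //; rewrite /g.
  case: pselect => [_ i|[] y yQ].
    rewrite /Q ffunE/= in_itv/=.
    by have := q1P i; have := q2P i; rewrite !in_itv/= => /andP[-> _] /andP[_ ->].
  apply: eU => i; have := yQ i; rewrite /Q ffunE/= in_itv/= => /andP[y1 y2].
  have := q1P i; have := q2P i; rewrite !in_itv/= => /andP[a1 a2] /andP[b1 b2].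
  by rewrite ltr_norml; rewrite /q1 /q2 in y1 y2; apply/andP; split; lra.
apply: countable_bigcupT_measurable => [|q]; first exact: countableP.
rewrite /g; case: pselect => [?|?]; last exact: measurable0.
exact: (@measurable_coord_itv _ _ (fun t => cube_val (f t))).
Qed.

End cube_theory.

Section cube_lebesgue.
Context (R : realType).

Let mu01 : probability (measurableTypeR R) R := uniform_prob (@ltr01 R).

Let mu01E (A : set R) : measurable A ->
  mu01 A = lebesgue_measure (A `&` `[0, 1]).
Proof.
move=> mA; rewrite /mu01 /= /uniform_prob integral_uniform_pdf.
rewrite (eq_integral (fun=> 1%:E)); last first.
  by move=> x; rewrite inE /= => -[_]; rewrite in_itv/= /uniform_pdf => ->;
    rewrite subr0 invr1.
by rewrite integral_cst ?mul1e//; exact: measurableI.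
Qed.

Let clamp (r : R) : R := Num.max 0 (Num.min 1 r).

Let clamp_itv (r : R) : 0 <= clamp r <= 1.
Proof. by rewrite /clamp le_max lexx/= ge_max ler01 ge_min lexx. Qed.

Let clamp_id (r : R) : 0 <= r <= 1 -> clamp r = r.
Proof.
by move=> /andP[r0 r1]; rewrite /clamp (min_idPr r1) (max_idPr r0).
Qed.

Let measurable_clamp : measurable_fun setT clamp.
Proof. by apply: measurable_maxr => //; exact: measurable_minr. Qed.

Section push.
Context (I : finType) d (T : measurableType d) (P : probability T R).
Variable f : T -> cube R I.
Hypothesis mf : forall i, measurable_fun setT (fun t => f t i).

Lemma cube_push : exists Q : probability (cube R I) R,
  forall A, Q A = P (f @^-1` A).
Proof.
pose F := HB.pack_for {mfun T >-> cube R I} f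
  (isMeasurableFun.Build _ _ _ _ f (measurable_fun_cube mf)).
by exists (distribution P F).
Qed.

End push.

Let cube_lebesgue_ord n : exists P : probability (cube R 'I_n) R,
  forall J : 'I_n -> interval R, (forall i, [set` J i] `<=` `[0, 1]) ->
  P (box J) = box_vol J.
Proof.
elim: n => [|n [P PE]].
  exists (\d_(point : cube R 'I_0)) => J _.
  rewrite /box_vol big_ord0 /= diracE mem_set//= => -[].
  by move=> ? [].
pose c (p : measurableTypeR R * cube R 'I_n) (i : 'I_n.+1) : R :=
  if unlift ord0 i is Some j then p.2 j else clamp p.1.
have c_itv p i : 0 <= c p i <= 1.
  by rewrite /c; case: unlift => [j|]; [exact: cube_itv|exact: clamp_itv].
have mc i : measurable_fun setT (c ^~ i).
  rewrite /c; case: unlift => [j|].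
    by apply: (measurableT_comp (measurable_cube_coord j)).
  exact: (measurableT_comp measurable_clamp).
have [Q QE] := @cube_push 'I_n.+1 _ _ (mu01 \x P)%E (fun p => Cube (c_itv p)) mc.
exists Q => J J01; rewrite {}QE.
have -> : (fun p => Cube (c_itv p)) @^-1` box J =
    (clamp @^-1` [set` J ord0]) `*` box (fun j => J (lift ord0 j)).
  apply/seteqP; split=> [[r x] /= rx|[r x] /= [rJ xJ] i].
    split=> [|j]; first by have := rx ord0; rewrite /= /c unlift_none.
    by have := rx (lift ord0 j); rewrite /= /c liftK.
  by rewrite /= /c; case: unliftP => [j ->|->]; [exact: xJ|].
have mJ : measurable (clamp @^-1` [set` J ord0]).
  by rewrite -[X in measurable X]setTI; apply: measurable_clamp.
refine (eq_trans (product_measure1E mu01 P mJ (measurable_box _)) _).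
rewrite /box_vol big_ord_recl; congr (_ * _)%E; last first.
  by apply: PE => i; exact: J01.
refine (eq_trans (mu01E mJ) _).
congr lebesgue_measure; apply/seteqP; split=> r /=.
  by move=> [rJ r01]; rewrite clamp_id in rJ.
move=> rJ; have r01 := J01 _ _ rJ; split => //.
by rewrite clamp_id//; move: r01; rewrite /= in_itv.
Qed.

Lemma cube_lebesgue_exists (I : finType) : exists P : probability (cube R I) R,
  forall J : I -> interval R, (forall i, [set` J i] `<=` `[0, 1]) ->
  P (box J) = box_vol J.
Proof.
have [P PE] := cube_lebesgue_ord #|I|.
pose f (x : cube R 'I_#|I|) : cube R I :=
  Cube (fun i => cube_itv x (enum_rank i)).
have [Q QE] := cube_push P (f := f) (fun i => measurable_cube_coord _).
exists Q => J J01; rewrite QE.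
have -> : f @^-1` box J = box (fun k => J (enum_val k)).
  apply/seteqP; split=> x /= xJ i; last by rewrite -{2}(enum_rankK i); exact: xJ.
  by rewrite -{1}(enum_valK i); exact: (xJ (enum_val i)).
rewrite PE; last by move=> i; exact: J01.
rewrite /box_vol [RHS](reindex_onto enum_val enum_rank)/=.
  by apply: eq_bigl => k; rewrite enum_valK eqxx.
by move=> i _; exact: enum_rankK.
Qed.

End cube_lebesgue.

Section network_law.
Context (R : realType) (V : finType).

Let measure_fsum d (T : measurableType d) (I : finType)
    (m : I -> {measure set T -> \bar R}) :
  exists M : {measure set T -> \bar R}, forall S, M S = (\sum_i m i S)%E.
Proof.
pose m' n : {measure set T -> \bar R} :=
  if insub n is Some k then m (enum_val (k : 'I_#|I|)) else mzero.
exists (msum m' #|I|) => S; rewrite /= /msum.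
rewrite [RHS](reindex_onto enum_val enum_rank) => [|i _]; last first.
  exact: enum_rankK.
apply: eq_big => [k|k _]; first by rewrite enum_valK eqxx.
by rewrite /m' valK.
Qed.

Let measurable_Network (A : {set V * V}) (s : signs A) :
  measurable_fun setT (@Network R V A s).
Proof. by move=> _ S mS; rewrite setTI; exact: mS. Qed.

Lemma Network_inj (A : {set V * V}) (s1 s2 : signs A)
    (T1 T2 : cube R (arcs A)) :
  Network s1 T1 = Network s2 T2 -> s1 = s2 /\ T1 = T2.
Proof.
pose pr (N : network R V) : option (signs A * cube R (arcs A)) :=
  if net_arcs N =P A is ReflectT e
  then Some (ecast B (signs B * cube R (arcs B))%type e (net_sign N, net_thr N))
  else None.
have prE s T : pr (Network s T) = Some (s, T).
  by rewrite /pr; case: eqP => //= e; rewrite eq_axiomK.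
by move=> /(congr1 pr); rewrite !prE => -[].
Qed.

Lemma measurable_network_box (A : {set V * V}) (s : signs A)
    (I : arcs A -> interval R) (J : V -> interval R) :
  measurable [set (Network s T, x) | T in box I & x in box J].
Proof.
have -> : [set (Network s T, x) | T in box I & x in box J] =
    [set Network s T | T in box I] `*` box J.
  apply/seteqP; split=> [_ [T TI [x xJ <-]]|[_ x] /= [[T TI <-] xJ]].
    by split=> //; exists T.
  by exists T => //; exists x.
apply: measurableX; last exact: measurable_box.
move=> B t; have [BA|BA] := eqVneq A B.
  subst B; have [<-|ts] := eqVneq s t.
    rewrite (_ : _ @^-1` _ = box I); first exact: measurable_box.
    apply/seteqP; split=> [T [T' T'I /Network_inj[_ <-]]//|T TI].
    by exists T.
  rewrite (_ : _ @^-1` _ = set0); first exact: measurable0.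
  rewrite -subset0 => T [T' _ /Network_inj[st _]].
  by rewrite st eqxx in ts.
rewrite (_ : _ @^-1` _ = set0); first exact: measurable0.
rewrite -subset0 => T [T' _ /(congr1 (@net_arcs R V))/= AB].
by rewrite AB eqxx in BA.
Qed.

Lemma sum_sign_prob (A : {set V * V}) (eta : R) :
  \sum_(s : signs A) sign_prob eta s = 1.
Proof.
rewrite /sign_prob.
rewrite -(bigA_distr_bigA (fun (e : arcs A) (b : bool) =>
  ((-1) ^+ b + 1) / 2 - (-1) ^+ b * eta)).
by rewrite big1// => e _; rewrite big_bool/= expr1 expr0; lra.
Qed.

Lemma sign_prob_ge0 (A : {set V * V}) (eta : R) (s : signs A) :
  0 <= eta <= 1 -> 0 <= sign_prob eta s.
Proof.
move=> /andP[eta0 eta1]; apply: prodr_ge0 => e _.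
by case: (s e); rewrite ?expr1 ?expr0; lra.
Qed.

Lemma network_law_exists (PG : {set V * V} -> R) (eta : R) :
  (forall A, 0 <= PG A) -> \sum_A PG A = 1 -> 0 <= eta <= 1 ->
  exists P : probability (network R V * cube R V)%type R,
    is_network_law PG eta P.
Proof.
move=> PG0 PG1 eta01.
pose mu I := projT1 (cid (cube_lebesgue_exists R I)).
have muE (I : finType) (J : I -> interval R) : (forall i, [set` J i] `<=` `[0, 1]) ->
    mu I (box J) = box_vol J by exact: (projT2 (cid (cube_lebesgue_exists R I))).
pose g (A : {set V * V}) (s : signs A) (p : cube R (arcs A) * cube R V) :=
  (Network s p.1, p.2).
have mg (A : {set V * V}) (s : signs A) : measurable_fun setT (@g A s).
  apply: measurable_fun_pair => //.
  exact: (measurableT_comp (@measurable_Network A s)).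
have w0 (A : {set V * V}) (s : signs A) : 0 <= PG A * sign_prob eta s.
  by rewrite mulr_ge0// sign_prob_ge0.
pose G (A : {set V * V}) (s : signs A) := HB.pack_for {mfun _ >-> _} (@g A s)
  (isMeasurableFun.Build _ _ _ _ (@g A s) (@mg A s)).
pose m (A : {set V * V}) (s : signs A) : {measure set (network R V * cube R V) -> \bar R} :=
  mscale (NngNum (w0 A s)) (distribution (mu (arcs A) \x mu V)%E (G A s)).
pose M1 (A : {set V * V}) := projT1 (cid (measure_fsum (@m A))).
have M1E (A : {set V * V}) S : M1 A S = (\sum_s m A s S)%E
  by exact: (projT2 (cid (measure_fsum (@m A)))).
have [M ME] := measure_fsum M1.
have mE (A : {set V * V}) (s : signs A) S : m A s S = ((PG A * sign_prob eta s)%:E *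
    (mu (arcs A) \x mu V) (@g A s @^-1` S))%E by [].
have MT : M setT = 1%E.
  rewrite ME (eq_bigr (fun A => (PG A)%:E)) => [|A _].
    by rewrite sumEFin PG1.
  rewrite M1E (eq_bigr (fun s => (PG A * sign_prob eta s)%:E)) => [|s _].
    by rewrite sumEFin -mulr_sumr sum_sign_prob mulr1.
  by rewrite mE preimage_setT probability_setT mule1.
exists (mnormalize M point) => A s I J I01 J01.
rewrite /= /mnormalize MT onee_eq0/= invr1 mule1.
rewrite ME (bigD1 A)//= [X in (_ + X)%E]big1 => [|B BA]; last first.
  rewrite M1E big1// => t _; rewrite mE (_ : @g B t @^-1` _ = set0).
    by rewrite measure0 mule0.
  rewrite -subset0 => -[T x] /= [T' _ [x' _ /(congr1 (@net_arcs R V \o fst))/= AB]].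
  by rewrite AB eqxx in BA.
rewrite adde0 M1E (bigD1 s)//= [X in (_ + X)%E]big1 => [|t ts]; last first.
  rewrite mE (_ : @g A t @^-1` _ = set0).
    by rewrite measure0 mule0.
  rewrite -subset0 => -[T x] /= [T' _ [x' _ /(congr1 fst)/Network_inj[st _]]].
  by rewrite st eqxx in ts.
rewrite adde0 mE -muleA -(muE _ I)// -(muE _ J)//; congr (_ * _)%E.
rewrite -product_measure1E; try exact: measurable_box.
congr ((_ \x _)%E _).
apply/seteqP; split=> -[T x] /=.
  move=> [T' T'I [x' x'J E]].
  have [_ /= TE] := Network_inj (congr1 fst E).
  by have /= xE := congr1 snd E; rewrite -TE -xE.
by move=> [TI xJ]; exists T => //; exists x.
Qed.

End network_law.

(* Main.v *)
Require Import Defs.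
From mathcomp Require Import all_boot all_order all_algebra.
From mathcomp Require Import all_classical all_reals all_analysis.
From mathcomp Require Import measurable_realfun lra ring zify.

Set Implicit Arguments.
Unset Strict Implicit.
Unset Printing Implicit Defensive.

Import Order.TTheory GRing.Theory Num.Theory.
Import numFieldNormedType.Exports.

Local Open Scope classical_set_scope.
Local Open Scope ring_scope.

(** Fix the arcs and the signs.  The drive [D (x)] depends on [x] only through
    the firing pattern, which tells for each arc whether it is active, so that
    along a trajectory the map is affine with linear part [a]: after [t] steps,
    [F ^ t (x) = a ^ t x + c], where the offset [c] depends only on the list of
    the [t] firing patterns met on the way, the history of [x]
    ([trajectoryE]).

    If a trajectory eventually stays at a positive distance [d] from all the
    thresholds, then it is asymptotically periodic: two of its late points lie
    within [d] of each other, hence have the same future firing patterns; so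
    the patterns are eventually periodic, and the trajectory converges to the
    fixed point of the composition of the affine maps along a period
    ([separated_trajectory_asymptotically_periodic]).  It remains to keep
    trajectories away from the thresholds, for almost all thresholds.

    The main point is that the number of histories of length [t] realised by
    some [x] and some thresholds [T], multiplied by [a ^ t], tends to [0] along a
    sequence of times ([history_subexponential]).  Near a given [(x0, T0)], an
    arc with source [u] is sensitive to the perturbation at time [k] only if the
    unperturbed state is exactly at the threshold, and then only through the sign of
    [a ^ k (x u - x0 u) - (T e - T0 e)], which is monotone in [k].  Hence
    there are at most [(2 (t + 1)) ^ #|E|] local histories of length [t]
    ([firing_local_count]), and for some [t] this times [a ^ t] is below [1].  By
    compactness the neighbourhoods can be taken to be balls of a fixed radius,
    and since the trajectories of a ball that share a history remain in a ball
    of the same radius, the local count can be iterated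
    ([history_iterated_count]).

    All the states at times [>= t] have their coordinates in the bands
    [[c, c + a ^ t]], [c] ranging over the offsets of the realised histories of
    length [t].  These bands do not depend on [T], and their total length tends
    to [0]; so the levels that lie in such bands for all [t], here called
    critical, form a null set.  Almost surely no threshold is critical, and then
    every trajectory eventually keeps away from the thresholds
    ([trajectory_separated]).

    As to measurability, a point of period [tau] equals [c / (1 - a ^ tau)] for
    the offset [c] of its history of length [tau].  The periodic points of all
    the networks are thus in a countable set, and the existence of a periodic
    point that attracts [x] is a countable union of conditions that are measurable
    in the network and in [x] ([measurable_has_asymptotic_period]). *)

(** * Uniformity on unit cubes *)

Definition unit_cube (R : realType) (I : Type) : set (I -> R) :=
  [set z | forall i, 0 <= z i <= 1].

Lemma finite_pos_lbound (R : realType) (I : finType) (f : I -> R) :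
  (forall i, 0 < f i) -> exists2 d, 0 < d & forall i, d <= f i.
Proof.
move=> f0; exists (\big[Num.min/1]_i f i).
  by apply: lt_bigmin.
by move=> i; apply: bigmin_le.
Qed.

(** Serves both for pigeonhole arguments and for covering a unit cube by
    finitely many sets of small diameter: the fibres of [code]. *)
Lemma unit_cube_finite_code (R : realType) (I : finType) (e : R) : 0 < e ->
  exists (G : finType) (code : (I -> R) -> G), forall z z',
    unit_cube z -> unit_cube z' -> code z = code z' ->
    forall i, `|z i - z' i| < e.
Proof.
move=> e0; pose N := Num.truncn e^-1.
exists {ffun I -> 'I_N.+1}, (fun z => [ffun i => inord (Num.truncn (z i / e))]).
move=> z z' z01 z'01 /ffunP zz' i; have := zz' i; rewrite !ffunE.
have lt_N y : 0 <= y <= 1 -> (Num.truncn (y / e) < N.+1)%N.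
  move=> /andP[y0 y1]; rewrite ltnS /N le_truncn//.
  by rewrite ler_piMl// invr_ge0 ltW.
have ge0 y : 0 <= y <= 1 -> 0 <= y / e.
  by move=> /andP[y0 _]; rewrite divr_ge0// ltW.
move/(congr1 val); rewrite /= !inordK ?lt_N// => E.
have /andP[A1 A2] := truncn_itv (ge0 _ (z01 i)).
have /andP[B1 B2] := truncn_itv (ge0 _ (z'01 i)).
rewrite -E in B1 B2.
rewrite ler_pdivlMr// in A1; rewrite ler_pdivlMr// in B1.
rewrite ltr_pdivrMr// in A2; rewrite ltr_pdivrMr// in B2.
rewrite -natr1 mulrDl mul1r in A2 B2.
by rewrite ltr_norml; apply/andP; split; lra.
Qed.

(** A Lebesgue number lemma, [Q z e] being read as a property of the ball of
    centre [z] and radius [e] that is inherited by the smaller balls it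
    contains. *)
Lemma unit_cube_lebesgue_number (R : realType) (I : finType)
    (Q : (I -> R) -> R -> Prop) :
  (forall z z' e e', Q z e -> 0 < e' ->
     (forall i, `|z i - z' i| + e' <= e) -> Q z' e') ->
  (forall z, unit_cube z -> exists2 e, 0 < e & Q z e) ->
  exists2 e, 0 < e & forall z, unit_cube z -> Q z e.
Proof.
move=> Qmono Qex.
pose K : set (prod_topology (fun _ : I => R)) :=
  [set z | forall i, `[0, 1]%classic (z i)].
have cK : compact K.
  apply: (@tychonoff I (fun=> R) (fun=> `[0, 1]%classic)) => i.
  exact: segment_compact.
have /compact_near_coveringP/(_ R (0^'+) (fun e z => Q z e)) := cK.
case=> [z Kz|e /= e0 eP].
  have [e e0 Qze] : exists2 e, 0 < e & Q z e.
    by apply: Qex => i; have := Kz i; rewrite /= in_itv.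
  have e20 : 0 < e / 2 by lra.
  have nz : nbhs z [set y : prod_topology (fun _ : I => R) |
      forall i, `|z i - y i| < e / 2].
    have Fz : Filter (nbhs z) by exact: nbhs_filter.
    apply: (@filter_forall _ _ (fun i (y : prod_topology (fun _ : I => R)) =>
      `|z i - y i| < e / 2) (nbhs z) Fz) => i.
    have : (fun y : prod_topology (fun _ : I => R) => y i) @ z --> z i.
      exact: (@proj_continuous I (fun=> R) i z).
    by move=> /cvgrPdist_lt/(_ _ e20).
  exists ([set y | forall i, `|z i - y i| < e / 2], [set r | 0 < r < e / 2]) => /=.
    split=> //; exists (e / 2) => //= r /=; rewrite sub0r normrN => r1 r0.
    by rewrite r0 /=; exact: le_lt_trans (ler_norm _) r1.
  move=> [y r] /= [yz /andP[r0 re]]; apply: Qmono Qze r0 _ => i.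
  by have := yz i; lra.
exists (e / 2) => [|z z01]; first by rewrite divr_gt0.
apply: (eP (e / 2)) => /=; rewrite ?divr_gt0//.
by rewrite sub0r normrN gtr0_norm ?divr_gt0// ltr_pdivrMr//; move: e0; rewrite /=;
  lra.
Qed.

(** * Threshold gates *)

Definition gate (R : realType) (H0 b : bool) (s : R) : bool :=
  let r := (-1) ^+ b * s in (0 < r) || ((r == 0) && H0).

Lemma gate_mono (R : realType) (H0 b : bool) (s s' : R) : s <= s' ->
  if b then gate H0 b s' ==> gate H0 b s else gate H0 b s ==> gate H0 b s'.
Proof.
move=> ss'; case: b; rewrite /gate ?expr1 ?expr0 ?mulN1r ?mul1r.
  apply/implyP => /orP[h|/andP[/eqP h ->]].
    by apply/orP; left; lra.
  rewrite andbT; case: ltrgt0P => //=; lra.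
apply/implyP => /orP[h|/andP[/eqP h ->]].
  by apply/orP; left; lra.
rewrite andbT; case: ltrgt0P => //=; lra.
Qed.

Lemma gate_near (R : realType) (H0 b : bool) (s s' : R) :
  `|s' - s| < `|s| -> gate H0 b s' = gate H0 b s.
Proof.
move=> h; rewrite /gate.
have [s0|s0|s0] := ltrgt0P s; last by move: h; rewrite s0 normr0 normr_lt0.
  have s'0 : 0 < s' by move: h; rewrite (gtr0_norm s0) ltr_norml => /andP[]; lra.
  case: b; rewrite ?expr1 ?expr0 ?mulN1r ?mul1r ?oppr_gt0 ?oppr_eq0 ?s0 ?s'0//.
  by rewrite !ltNge !ltW//= !gt_eqF.
have s'0 : s' < 0 by move: h; rewrite (ltr0_norm s0) ltr_norml => /andP[]; lra.
case: b; rewrite ?expr1 ?expr0 ?mulN1r ?mul1r ?oppr_gt0 ?oppr_eq0 ?s0 ?s'0//.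
by rewrite !ltNge !ltW//= !lt_eqF.
Qed.

Lemma heaviside_gate (R : realType) (H0 b : bool) (s : R) :
  heaviside H0 ((-1) ^+ b * s) = (gate H0 b s)%:R.
Proof.
by rewrite /heaviside /gate; case: ltrgt0P => //= _; case: H0.
Qed.

(** The pair [(c, j)] is the first value together with the time of the switch,
    [j = t] if there is none: there are [2 (t + 1)] monotone sequences of
    booleans of length [t] at most. *)
Lemma monotone_bool_seq (t : nat) (f : nat -> bool) :
  (forall i j, (i <= j)%N -> f i ==> f j) \/
  (forall i j, (i <= j)%N -> f j ==> f i) ->
  exists (c : bool) (j : 'I_t.+1),
    forall k, (k < t)%N -> f k = if (k < j)%N then c else ~~ c.
Proof.
move=> mf; exists (f 0).
have jt : (find (fun k => f k != f 0) (iota 0 t) < t.+1)%N.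
  by rewrite ltnS -[X in (_ <= X)%N](size_iota 0 t) find_size.
exists (Ordinal jt) => k kt /=; case: ltnP => [kj|jk].
  by have := before_find 0%N kj; rewrite nth_iota// add0n => /negbFE/eqP.
set j := find _ _ in jt jk.
have : f j != f 0.
  have /(nth_find 0%N) : has (fun k => f k != f 0) (iota 0 t).
    by rewrite has_find size_iota (leq_ltn_trans jk).
  by rewrite nth_iota ?add0n// (leq_ltn_trans jk).
by case: mf => mf; have := mf 0%N j (leq0n _); have := mf j k jk;
  case: (f j); case: (f 0); case: (f k).
Qed.

(** * Trajectories and their firing histories *)

Section threshold_dynamics.
Context (R : realType) (V E : finType) (src : E -> V) (sgn : E -> bool).
Context (drv : {ffun E -> bool} -> V -> R) (H0 : bool) (a : R).
Implicit Types (x : V -> R) (T : E -> R) (w : seq {ffun E -> bool}).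

Definition firing T x : {ffun E -> bool} :=
  [ffun e => gate H0 (sgn e) (x (src e) - T e)].

Definition step T x (v : V) : R := a * x v + (1 - a) * drv (firing T x) v.

Definition trajectory T x (t : nat) : V -> R := iter t (step T) x.

(** The latest pattern comes first, so that [offset], which adds the
    contribution of the last step, is structurally recursive. *)
Fixpoint history T x (t : nat) : seq {ffun E -> bool} :=
  if t is t'.+1 then firing T (trajectory T x t') :: history T x t' else [::].

Fixpoint offset w (v : V) : R :=
  if w is th :: w' then a * offset w' v + (1 - a) * drv th v else 0.

Lemma trajectoryE T x t v :
  trajectory T x t v = a ^+ t * x v + offset (history T x t) v.
Proof.
elim: t v => [|t IH] v /=; first by rewrite expr0 mul1r addr0.
by rewrite -/(trajectory T x t) /step IH exprS; ring.
Qed.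

Lemma size_history T x t : size (history T x t) = t.
Proof. by elim: t => //= t ->. Qed.

Lemma trajectoryD T x s t :
  trajectory T x (s + t) = trajectory T (trajectory T x s) t.
Proof. by rewrite /trajectory addnC iterD. Qed.

Lemma historyD T x s t :
  history T x (s + t) = history T (trajectory T x s) t ++ history T x s.
Proof.
elim: t => [|t IH]; first by rewrite addn0.
by rewrite addnS /= IH trajectoryD.
Qed.

Hypothesis ha : 0 <= a < 1.

(** * Counting histories *)

(** A history of length [t] near [(x0, T0)] is determined by one monotone
    sequence of booleans per arc.  Given the past, the state of a perturbed
    trajectory at time [k] minus the threshold is [g + h] with [g] the same
    quantity for the affine branch through [x0] and
    [h = a ^+ k * (x - x0) - (T - T0)].  If [g != 0], then [h] is too small to
    change its sign; if [g = 0], the sign is that of [h], which is monotone in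
    [k]. *)
Lemma firing_local_count t x0 T0 :
  exists2 eps, 0 < eps & exists2 S : seq (seq {ffun E -> bool}),
    (size S <= (2 * t.+1) ^ #|E|)%N &
    forall x T, (forall v, `|x v - x0 v| < eps) ->
      (forall e, `|T e - T0 e| < eps) -> history T x t \in S.
Proof.
pose M := {ffun E -> bool * 'I_t.+1}.
pose gap k w e := a ^+ k * x0 (src e) + offset w (src e) - T0 e.
(* The history reconstructed from the switching data m of the arcs. *)
pose rec := fix rec (m : M) k := if k is k'.+1 then
  [ffun e => if gap k' (rec m k') e == 0
             then (if (k' < (m e).2)%N then (m e).1 else ~~ (m e).1)
             else gate H0 (sgn e) (gap k' (rec m k') e)] :: rec m k'
  else [::].
pose room (i : M * 'I_t * E) := let g := gap i.1.2 (rec i.1.1 i.1.2) i.2 in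
  if g == 0 then 1 else `|g|.
have room0 i : 0 < room i.
  by rewrite /room /=; case: ifPn => // g0; rewrite normr_gt0.
(* The perturbation h is at most twice the radius, hence d / 2 below. *)
have [d d0 dP] := finite_pos_lbound room0.
exists (d / 2); first by lra.
exists [seq rec m t | m : M].
  by rewrite size_map -cardE card_ffun card_prod card_bool card_ord.
move=> x T xx0 TT0.
have [m mP] : exists m : M, forall e k, (k < t)%N ->
    gate H0 (sgn e) (a ^+ k * (x (src e) - x0 (src e)) - (T e - T0 e)) =
    if (k < (m e).2)%N then (m e).1 else ~~ (m e).1.
  have /choice[m mP] : forall e, exists p : bool * 'I_t.+1, forall k, (k < t)%N ->
      gate H0 (sgn e) (a ^+ k * (x (src e) - x0 (src e)) - (T e - T0 e)) =
      if (k < p.2)%N then p.1 else ~~ p.1.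
    move=> e; have [|c [j cj]] := @monotone_bool_seq t (fun k =>
        gate H0 (sgn e) (a ^+ k * (x (src e) - x0 (src e)) - (T e - T0 e))).
      have aij i j : (i <= j)%N -> a ^+ j <= a ^+ i.
        by move=> ij; case/andP: ha => a0 a1; rewrite ler_wiXn2l// ltW.
      have [dx|dx] := lerP 0 (x (src e) - x0 (src e)).
        have mo i j : (i <= j)%N -> a ^+ j * (x (src e) - x0 (src e)) - (T e - T0 e)
            <= a ^+ i * (x (src e) - x0 (src e)) - (T e - T0 e).
          by move=> /aij ij; rewrite lerD2r ler_wpM2r.
        by case: (sgn e) (fun b => @gate_mono R H0 b) => g;
          [left|right] => i j /mo; [exact: (g true)|exact: (g false)].
      have mo i j : (i <= j)%N -> a ^+ i * (x (src e) - x0 (src e)) - (T e - T0 e)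
          <= a ^+ j * (x (src e) - x0 (src e)) - (T e - T0 e).
        by move=> /aij ij; rewrite lerD2r ler_wnM2r// ltW.
      by case: (sgn e) (fun b => @gate_mono R H0 b) => g;
        [right|left] => i j /mo; [exact: (g true)|exact: (g false)].
    by exists (c, j).
  by exists [ffun e => m e] => e k; rewrite ffunE; exact: mP.
apply/mapP; exists m; first by rewrite mem_enum.
have : (t <= t)%N by [].
elim: {-2}t => // k IH kt /=; rewrite -IH ?(ltnW kt)//; congr (_ :: _).
apply/ffunP => e; rewrite !ffunE trajectoryE.
set g := gap k _ e.
have -> : a ^+ k * x (src e) + offset (history T x k) (src e) - T e =
    g + (a ^+ k * (x (src e) - x0 (src e)) - (T e - T0 e)).
  by rewrite /g /gap; ring.
have [->|g0] := eqVneq g 0; first by rewrite add0r mP.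
apply: gate_near; rewrite addrAC subrr add0r.
apply: (@lt_le_trans _ _ d).
  apply: le_lt_trans (ler_normB _ _) _.
  rewrite normrM.
  have ak : `|a ^+ k| <= 1.
    by case/andP: ha => a0 a1; rewrite normrX ger0_norm// exprn_ile1// ltW.
  have := xx0 (src e); have := TT0 e; have := normr_ge0 (x (src e) - x0 (src e)).
  by move: ak; nra.
have := dP (m, Ordinal kt, e); rewrite /room /= -IH ?(ltnW kt)// -/g.
by rewrite (negbTE g0).
Qed.


Hypothesis drv01 : forall th v, 0 <= drv th v <= 1.

Let a_ge0 : 0 <= a. Proof. by case/andP: ha. Qed.
Let a_le1 : a <= 1. Proof. by case/andP: ha => _ /ltW. Qed.

(** An offset is a sum of drives, with weights [(1 - a) * a ^+ k], [k] running
    below the length of the history. *)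
Lemma offset_itv w v : 0 <= offset w v <= 1 - a ^+ size w.
Proof.
elim: w => [|th w /andP[IH0 IH1]] /=; first by rewrite expr0 subrr lexx.
have /andP[d0 d1] := drv01 th v; rewrite exprS.
have a0 := a_ge0; have a1 : 0 <= 1 - a by rewrite subr_ge0 a_le1.
have : a * offset w v <= a * (1 - a ^+ size w) by rewrite ler_wpM2l.
have : (1 - a) * drv th v <= (1 - a) * 1 by rewrite ler_wpM2l.
have : 0 <= a * offset w v by rewrite mulr_ge0.
have : 0 <= (1 - a) * drv th v by rewrite mulr_ge0.
by move=> ? ? ? ?; apply/andP; split; lra.
Qed.

Lemma affine_cube t w x : size w = t -> unit_cube x ->
  unit_cube (fun v => a ^+ t * x v + offset w v).
Proof.
move=> <- x01 v; have /andP[f0 f1] := offset_itv w v; have /andP[x0 x1] := x01 v.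
have A0 : 0 <= a ^+ size w by exact: exprn_ge0.
by apply/andP; split; nra.
Qed.

Lemma trajectory_cube T x t : unit_cube x -> unit_cube (trajectory T x t).
Proof.
by move=> x01 v; rewrite trajectoryE; exact: (affine_cube (size_history T x t) x01).
Qed.

(** By Bernoulli's inequality [a ^+ i * (1 + i * (1 - a)) <= 1], the number
    [a ^+ (2 * i)] is [O (i ^- 2)], which beats a linear factor; with
    [t = 2 * i * m], the statement is the [m]-th power of that case. *)
Lemma exp_beats_poly m : exists t : nat, ((2 * t.+1) ^ m)%:R * a ^+ t < 1.
Proof.
have bern (i : nat) : a ^+ i * (1 + i%:R * (1 - a)) <= 1.
  elim: i => [|i IH]; first by rewrite expr0 mul0r addr0 mulr1.
  have A0 : 0 <= a ^+ i by exact: exprn_ge0.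
  have A1 : a ^+ i <= 1 by exact: exprn_ile1.
  rewrite exprS -natr1; move: IH; set b := a ^+ i in A0 A1 *.
  have h0 : 0 <= a * (1 - a) by rewrite mulr_ge0// subr_ge0.
  have -> : a * b * (1 + (i%:R + 1) * (1 - a)) =
     a * (b * (1 + i%:R * (1 - a))) + (a * (1 - a)) * b by ring.
  set X := b * _ => X1.
  have : a * X <= a * 1 by rewrite ler_wpM2l.
  have : a * (1 - a) * b <= a * (1 - a) * 1 by rewrite ler_wpM2l.
  by have := sqr_ge0 (1 - a); rewrite expr2; lra.
have h0 : 0 < 1 - a by case/andP: ha; lra.
case: m => [|m]; first by exists 1%N; rewrite expn0 mul1r expr1; case/andP: ha.
pose c : R := (4 * m.+1 + 2)%:R.
have [i iP] : exists i : nat, 2 * c / (1 - a) ^+ 2 < i%:R.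
  exists (Num.truncn (2 * c / (1 - a) ^+ 2)).+1; exact: truncnS_gt.
rewrite ltr_pdivrMr ?exprn_gt0// in iP.
exists (m.+1 * (2 * i))%N.
have i1 : (0 < i)%N.
  rewrite lt0n; apply: contraPneq iP => ->; apply/negP.
  by rewrite -leNgt mul0r mulr_ge0.
rewrite [(_ * (2 * i))%N]mulnC exprM natrX -exprMn exprn_ilt1//.
- by rewrite mulr_ge0// ?exprn_ge0.
- have bi := bern i.
  rewrite [(2 * i)%N]mulnC exprM.
  have ci : (2 * (i * 2 * m.+1).+1)%:R <= c * i%:R.
    rewrite -natrM ler_nat; move: i1; clear; nia.
  set b := a ^+ i in bi *.
  have b0 : 0 <= b by exact: exprn_ge0.
  have bih : b * (i%:R * (1 - a)) <= 1 by nra.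
  have bih0 : 0 <= b * (i%:R * (1 - a)) by rewrite !mulr_ge0// ltW.
  have : (b * (i%:R * (1 - a))) ^+ 2 <= 1 by rewrite exprn_ile1.
  rewrite !exprMn => sq.
  have b20 : 0 <= b ^+ 2 by rewrite exprn_ge0.
  have c1 : 2 * (c * i%:R) <= i%:R ^+ 2 * (1 - a) ^+ 2.
    have : 2 * c * i%:R <= i%:R * (1 - a) ^+ 2 * i%:R by rewrite ler_wpM2r// ltW.
    by rewrite !expr2 => ?; lra.
  have h1 : (2 * (i * 2 * m.+1).+1)%:R * b ^+ 2 <= c * i%:R * b ^+ 2.
    by rewrite ler_wpM2r.
  have h2 : 2 * (c * i%:R) * b ^+ 2 <= i%:R ^+ 2 * (1 - a) ^+ 2 * b ^+ 2.
    by rewrite ler_wpM2r.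
  rewrite (mulrC (b ^+ 2)) in sq; have h3 := le_trans h2 sq.
  by apply: le_lt_trans h1 _; rewrite -mulrA in h3; lra.
Qed.

Lemma history_uniform_count t :
  exists2 eps, 0 < eps & forall x0 T0, unit_cube x0 -> unit_cube T0 ->
    exists2 S : seq (seq {ffun E -> bool}),
      (size S <= (2 * t.+1) ^ #|E|)%N &
      forall x T, (forall v, `|x v - x0 v| < eps) ->
        (forall e, `|T e - T0 e| < eps) -> history T x t \in S.
Proof.
pose Q (z : V + E -> R) eps := exists2 S : seq (seq {ffun E -> bool}),
  (size S <= (2 * t.+1) ^ #|E|)%N &
  forall x T, (forall v, `|x v - z (inl v)| < eps) ->
    (forall e, `|T e - z (inr e)| < eps) -> history T x t \in S.
have [|z z01|eps eps0 Qeps] := @unit_cube_lebesgue_number R (V + E)%type Q.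
- move=> z z' e e' [S S1 S2] e'0 zz'; exists S => // x T xz' Tz'.
  have tri (y : R) i : `|y - z' i| < e' -> `|y - z i| < e.
    move=> yz'; apply: lt_le_trans (zz' i); rewrite (distrC (z i)).
    apply: le_lt_trans (ler_distD (z' i) _ _) _; lra.
  by apply: S2 => i; apply: tri; [exact: xz'|exact: Tz'].
- have [e e0 [S S1 S2]] := firing_local_count t (z \o inl) (z \o inr).
  by exists e => //; exists S.
exists eps => // x0 T0 x01 T01.
have [|S S1 S2] := Qeps (fun i => match i with inl v => x0 v | inr e => T0 e end).
  by case=> [v|e]; [exact: x01|exact: T01].
by exists S.
Qed.

(** Points of a ball that share their first [t] patterns are mapped affinely
    with linear part [a ^+ t <= 1]; so after [t] steps they are in a ball of the
    same radius [eps], whose centre is the image of [x0] under that affine map,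
    and the same bound applies again. *)
Lemma history_iterated_count t K eps :
  (forall x0 T0, unit_cube x0 -> unit_cube T0 ->
    exists2 S : seq (seq {ffun E -> bool}), (size S <= K)%N &
      forall x T, (forall v, `|x v - x0 v| < eps) ->
        (forall e, `|T e - T0 e| < eps) -> history T x t \in S) ->
  forall n x0 T0, unit_cube x0 -> unit_cube T0 ->
    exists2 S : seq (seq {ffun E -> bool}), (size S <= K ^ n)%N &
      forall x T, (forall v, `|x v - x0 v| < eps) ->
        (forall e, `|T e - T0 e| < eps) -> history T x (n * t) \in S.
Proof.
move=> unif; elim=> [|n IH] x0 T0 x01 T01; first by exists [:: [::]].
have [S S1 S2] := unif _ _ x01 T01.
(* U w bounds the continuations of the words w of length t; other words do not
   occur as first segments. *)
have /choice[U UP] : forall w : seq {ffun E -> bool},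
    exists U : seq (seq {ffun E -> bool}),
    (size U <= K ^ n)%N /\ (size w = t -> forall x T,
      (forall v, `|x v - (a ^+ t * x0 v + offset w v)| < eps) ->
      (forall e, `|T e - T0 e| < eps) -> history T x (n * t) \in U).
  move=> w; have [wt|wt] := eqVneq (size w) t; last first.
    by exists [::]; split => // h; rewrite h eqxx in wt.
  by have [U U1 U2] := IH _ _ (affine_cube wt x01) T01; exists U.
exists [seq u ++ w | w <- S, u <- U w].
  rewrite size_allpairs_dep expnS.
  apply: (@leq_trans (sumn [seq K ^ n | w <- S])%N).
    by rewrite !sumnE !big_map; apply: leq_sum => w _; have [] := UP w.
  rewrite sumnE big_map big_const_seq count_predT iter_addn_0 mulnC.
  by rewrite leq_mul2r S1 orbT.
move=> x T xx0 TT0; rewrite mulSn historyD.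
apply: allpairs_f_dep; first exact: S2.
have [_ h] := UP (history T x t); apply: h => //; first exact: size_history.
move=> v; rewrite trajectoryE opprD addrACA subrr addr0 -mulrBr normrM.
rewrite ger0_norm ?exprn_ge0//; apply: le_lt_trans (xx0 v).
by rewrite ler_piMl// exprn_ile1.
Qed.

Definition history_cover t (S : seq (seq {ffun E -> bool})) :=
  forall x T, unit_cube x -> unit_cube T -> history T x t \in S.

(** Choose [t0] with [K * a ^+ t0 < 1], [K] being the local bound for histories
    of length [t0]; then there are at most [M * K ^ n] histories of length
    [n * t0], where [M] is the number of sets of small diameter needed to cover the
    cubes of states and thresholds. *)
Lemma history_subexponential eta : 0 < eta ->
  exists (t : nat) (S : seq (seq {ffun E -> bool})),
    (size S)%:R * a ^+ t < eta /\ history_cover t S.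
Proof.
move=> eta0; have [t Kt] := exp_beats_poly #|E|.
set K := (_ ^ _)%N in Kt.
have [eps eps0 /history_iterated_count count] := history_uniform_count t.
have [G [code codeP]] := @unit_cube_finite_code R (V + E)%type _ eps0.
pose join (x : V -> R) (T : E -> R) i :=
  match i with inl v => x v | inr e => T e end.
have r0 : 0 <= K%:R * a ^+ t by rewrite mulr_ge0// exprn_ge0.
have [n nP] : exists n, #|G|%:R * (K%:R * a ^+ t) ^+ n < eta.
  have : (fun n => #|G|%:R * (K%:R * a ^+ t) ^+ n) @ \oo --> #|G|%:R * (0 : R).
    by apply: cvgMr; apply: cvg_expr; rewrite ger0_norm.
  rewrite mulr0 => /cvgrPdist_lt/(_ _ eta0)[n _ /(_ n (leqnn n))].
  rewrite /= sub0r normrN => h; exists n; exact: le_lt_trans (ler_norm _) h.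
have /choice[U UP] : forall g : G, exists U : seq (seq {ffun E -> bool}),
    (size U <= K ^ n)%N /\ forall x T, unit_cube x -> unit_cube T ->
      code (join x T) = g -> history T x (n * t) \in U.
  move=> g; have [[x0 [T0 [x01 T01 g0]]]|no] := pselect (exists x0 T0,
      [/\ unit_cube x0, unit_cube T0 & code (join x0 T0) = g]).
    have [U U1 U2] := count n _ _ x01 T01; exists U; split=> // x T x1 T1 gxT.
    have j01 y S : unit_cube y -> unit_cube S -> unit_cube (join y S).
      by move=> y1 S1 [v|e]; [exact: y1|exact: S1].
    have cl := codeP _ _ (j01 _ _ x1 T1) (j01 _ _ x01 T01) (etrans gxT (esym g0)).
    by apply: U2 => i; [exact: (cl (inl i))|exact: (cl (inr i))].
  exists [::]; split=> // x T x1 T1 gxT; case: no; exists x, T; split=> //.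
exists (n * t)%N, (flatten [seq U g | g <- enum G]); split.
  apply: le_lt_trans nP; rewrite exprMn -exprM mulrA mulnC.
  rewrite ler_wpM2r ?exprn_ge0// -natrX -natrM ler_nat.
  rewrite size_flatten /shape sumnE !big_map.
  apply: (@leq_trans (\sum_(g <- enum G) K ^ n)%N).
    by rewrite big_map; apply: leq_sum => g _; have [] := UP g.
  by rewrite big_const_seq count_predT iter_addn_0 -cardE mulnC.
move=> x T x1 T1; apply/flatten_mapP; exists (code (join x T)).
  by rewrite mem_enum.
by have [_ h] := UP (code (join x T)); apply: h.
Qed.

(** The state at time [s] is also the state at time [t] of the trajectory of an
    earlier state, so the bands of time [t] contain all later states. *)
Lemma trajectory_in_band (S : seq (seq {ffun E -> bool})) t s x T v :
  history_cover t S ->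
  unit_cube x -> unit_cube T -> (t <= s)%N ->
  exists2 w, w \in S & offset w v <= trajectory T x s v <= offset w v + a ^+ t.
Proof.
move=> SP x01 T01 ts; have y01 := trajectory_cube T (s - t) x01.
exists (history T (trajectory T x (s - t)) t); first exact: SP.
rewrite -{2 3}(subnK ts) trajectoryD trajectoryE.
have /andP[y0 y1] := y01 v; have A0 : 0 <= a ^+ t by exact: exprn_ge0.
by apply/andP; split; nra.
Qed.

(** * Trajectories that stay away from the thresholds *)

(** As long as the two trajectories fire identically their distance does not
    increase, hence remains below the distance [d] of the first one to the
    thresholds; so they fire identically forever. *)
Lemma trajectory_shadowing T x z d :
  (forall k e, d <= `|trajectory T x k (src e) - T e|) ->
  (forall v, `|z v - x v| < d) ->
  forall k, firing T (trajectory T z k) = firing T (trajectory T x k) /\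
    forall v, trajectory T z k v - trajectory T x k v = a ^+ k * (z v - x v).
Proof.
move=> sep zx.
have fire k : (forall v,
      trajectory T z k v - trajectory T x k v = a ^+ k * (z v - x v)) ->
    firing T (trajectory T z k) = firing T (trajectory T x k).
  move=> E0; apply/ffunP => e; rewrite !ffunE; apply: gate_near.
  apply: lt_le_trans (sep k e); rewrite opprB addrA subrK E0 normrM.
  rewrite ger0_norm ?exprn_ge0//; apply: le_lt_trans (zx (src e)).
  by rewrite ler_piMl// exprn_ile1.
suff E1 k : forall v, trajectory T z k v - trajectory T x k v = a ^+ k * (z v - x v).
  by move=> k; split=> //; exact: fire.
elim: k => [|k IH] v; first by rewrite expr0 mul1r.
rewrite /= -/(trajectory T z k) -/(trajectory T x k) /step fire//.
by rewrite exprS -mulrA -IH; ring.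
Qed.

Lemma eq_history T x y p :
  (forall k, firing T (trajectory T x k) = firing T (trajectory T y k)) ->
  history T x p = history T y p.
Proof. by move=> xy; elim: p => //= p ->; rewrite xy. Qed.

Lemma separated_trajectory_recurrent T x N d : unit_cube x -> 0 < d ->
  exists i j, [/\ (N <= i)%N, (i < j)%N &
    forall v, `|trajectory T x j v - trajectory T x i v| < d].
Proof.
move=> x01 d0; have [G [code codeP]] := @unit_cube_finite_code R V _ d0.
pose f (k : 'I_#|G|.+1) := code (trajectory T x (N + k)).
have : ~~ injectiveb f.
  by apply/negP => /injectiveP/leq_card; rewrite card_ord ltnn.
have orb01 k := trajectory_cube T k x01.
case/injectivePn => k [l kl fkl].
have close : forall v, `|trajectory T x (N + k) v - trajectory T x (N + l) v| < d.
  exact: codeP fkl.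
have [kl'|lk] := ltnP k l.
  exists (N + k)%N, (N + l)%N; split; rewrite ?leq_addr ?ltn_add2l// => v.
  by rewrite distrC.
exists (N + l)%N, (N + k)%N; split; rewrite ?leq_addr// ltn_add2l.
by rewrite ltn_neqAle lk andbT eq_sym.
Qed.

Lemma separated_trajectory_asymptotically_periodic T x N d : unit_cube x -> 0 < d ->
  (forall s e, (N <= s)%N -> d <= `|trajectory T x s (src e) - T e|) ->
  exists m p z, [/\ (0 < p)%N, unit_cube z, trajectory T z p =1 z &
    forall k v, trajectory T z k v - trajectory T x (m + k) v =
      a ^+ k * (z v - trajectory T x m v)].
Proof.
move=> x01 d0 sep.
(* By shadowing, a return within d makes the firing patterns periodic after
   time i, with period p. *)
have [i [j [Ni ij closeij]]] := separated_trajectory_recurrent T N x01 d0.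
pose p := (j - i)%N; have p0 : (0 < p)%N by rewrite subn_gt0.
have sepi k e : d <= `|trajectory T (trajectory T x i) k (src e) - T e|.
  by rewrite -trajectoryD; apply: sep; rewrite (leq_trans Ni)// leq_addr.
have per k : firing T (trajectory T x (i + p + k)) =
    firing T (trajectory T x (i + k)).
  rewrite subnKC ?(ltnW ij)// !trajectoryD.
  by have [] := trajectory_shadowing sepi closeij k.
have pern n k : firing T (trajectory T x (i + n * p + k)) =
    firing T (trajectory T x (i + k)).
  elim: n k => [|n IH] k; first by rewrite mul0n addn0.
  by rewrite mulSn -addnA -addnA (addnA i p) per addnA IH.
have histn n : history T (trajectory T x (i + n * p)) p =
    history T (trajectory T x i) p.
  by apply: eq_history => k; rewrite -!trajectoryD pern.
pose w := history T (trajectory T x i) p.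
have szw : size w = p by exact: size_history.
have ap1 : 0 < 1 - a ^+ p.
  by rewrite subr_gt0 exprn_ilt1// -?lt0n//; case/andP: ha.
(* The fixed point of x |-> a ^+ p * x + offset w.  That the network maps z to
   itself in p steps is only known once a point of the trajectory shadows z. *)
pose z v := offset w v / (1 - a ^+ p).
have zE v : a ^+ p * z v + offset w v = z v.
  have -> : offset w v = (1 - a ^+ p) * z v by rewrite /z mulrC divfK// gt_eqF.
  by ring.
have z01 : unit_cube z.
  move=> v; have /andP[f0 f1] := offset_itv w v; rewrite szw in f1.
  by rewrite /z divr_ge0 ?(ltW ap1)//= ler_pdivrMr// mul1r.
have toz n v : z v - trajectory T x (i + n * p) v =
    (a ^+ p) ^+ n * (z v - trajectory T x i v).
  elim: n => [|n IH]; first by rewrite mul0n addn0 expr0 mul1r.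
  rewrite mulSn (addnC p) addnA trajectoryD trajectoryE histn -/w exprS -mulrA -IH.
  by rewrite -{1}zE; ring.
have [n nd] : exists n, (a ^+ p) ^+ n < d.
  have : (fun n => (a ^+ p) ^+ n) @ \oo --> (0 : R).
    by apply: cvg_expr; rewrite ger0_norm ?exprn_ge0//; lra.
  move=> /cvgrPdist_lt/(_ _ d0)[n _ /(_ n (leqnn n))].
  rewrite /= sub0r normrN => h; exists n; exact: le_lt_trans (ler_norm _) h.
pose m := (i + n * p)%N.
have sepm k e : d <= `|trajectory T (trajectory T x m) k (src e) - T e|.
  by rewrite -trajectoryD; apply: sep; rewrite (leq_trans Ni)// /m -addnA leq_addr.
have closem v : `|z v - trajectory T x m v| < d.
  rewrite toz normrM ger0_norm ?exprn_ge0//; apply: le_lt_trans nd.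
  rewrite ler_piMr ?exprn_ge0//.
  have /andP[y0 y1] := trajectory_cube T i x01 v; have /andP[z0 z1] := z01 v.
  by rewrite ler_norml; apply/andP; split; lra.
have shadow := trajectory_shadowing sepm closem.
exists m, p, z; split=> //.
  move=> v; rewrite trajectoryE (_ : history T z p = w) ?zE//.
  by rewrite /w -(histn n); apply: eq_history => k; have [] := shadow k.
by move=> k v; rewrite trajectoryD; have [_ ->] := shadow k.
Qed.

(** Periodic points depend neither on the thresholds nor on the signs, except
    through their history; this makes them countably many. *)
Lemma periodic_point_offset T z p : (0 < p)%N -> trajectory T z p =1 z ->
  forall v, z v = offset (history T z p) v / (1 - a ^+ p).
Proof.
move=> p0 zp v; have /eqP := zp v; rewrite trajectoryE => /eqP zE.
have ap1 : 0 < 1 - a ^+ p.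
  by rewrite subr_gt0 exprn_ilt1// -?lt0n//; case/andP: ha.
apply: (@mulIf _ (1 - a ^+ p)); first by rewrite gt_eqF.
by rewrite divfK ?gt_eqF//; lra.
Qed.

Definition in_bands (t : nat) (S : seq (seq {ffun E -> bool})) v (r : R) :=
  exists2 w, w \in S & offset w v <= r <= offset w v + a ^+ t.

(** Levels that some trajectory may approach at arbitrarily late times. *)
Definition critical v (r : R) :=
  forall t S, history_cover t S -> in_bands t S v r.

(** The finitely many bands of time [t] are closed, hence at a positive distance
    from a level outside them. *)
Lemma trajectory_separated_from t S x v r :
  history_cover t S ->
  unit_cube x -> ~ in_bands t S v r ->
  exists2 d, 0 < d & forall T s, unit_cube T -> (t <= s)%N ->
    d <= `|trajectory T x s v - r|.
Proof.
move=> SP x01 nr.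
pose gap (u : seq_sub S) :=
  Num.max (offset (val u) v - r) (r - (offset (val u) v + a ^+ t)).
have gap0 u : 0 < gap u.
  rewrite lt_max !subr_gt0 !ltNge -negb_and; apply/negP => ru.
  by apply: nr; exists (val u) => //; exact: valP.
have [d d0 dP] := finite_pos_lbound gap0.
exists d => // T s T01 ts.
have [w wS /andP[w1 w2]] := trajectory_in_band v SP x01 T01 ts.
have := dP (SeqSub wS); rewrite /gap le_max /= => /orP[] h.
  by rewrite ler_normr; apply/orP; left; lra.
by rewrite ler_normr; apply/orP; right; lra.
Qed.

Lemma trajectory_separated T x : unit_cube x -> unit_cube T ->
  (forall e, ~ critical (src e) (T e)) ->
  exists N d, 0 < d /\
    forall s e, (N <= s)%N -> d <= `|trajectory T x s (src e) - T e|.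
Proof.
move=> x01 T01 generic.
have /choice[g gP] : forall e, exists p : nat * R, 0 < p.2 /\
    forall s, (p.1 <= s)%N -> p.2 <= `|trajectory T x s (src e) - T e|.
  move=> e; have [t [S [SP nb]]] : exists t S,
      history_cover t S /\ ~ in_bands t S (src e) (T e).
    apply: contrapT => h; apply: (generic e) => t S SP; apply: contrapT => nb.
    by apply: h; exists t, S.
  have [d d0 dP] := trajectory_separated_from SP x01 nb.
  by exists (t, d); split=> //= s ts; exact: dP.
have [d d0 dP] := finite_pos_lbound (fun e => (gP e).1).
exists (\max_e (g e).1)%N, d; split=> // s e Ns.
apply: le_trans (dP e) _; apply: (gP e).2.
by apply: leq_trans Ns; exact: leq_bigmax.
Qed.

End threshold_dynamics.

(** A preimage [y] of [z] under [F ^ m] is found on the cycle of [z], and has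
    the same asymptotic behaviour as [x] without the time shift [m]. *)
Lemma eventually_periodic_asymptotic (R : realType) (V : finType)
    (F : cube R V -> cube R V) (x z : cube R V) (m p : nat) :
  (0 < p)%N -> iter p F z = z ->
  (fun k => Defs.edist (iter (m + k) F x) (iter k F z)) @ \oo --> (0 : R) ->
  exists tau, has_asymptotic_period F x tau.
Proof.
move=> p0 zp cv; pose y := iter (m * p.-1) F z.
have itern n : iter (n * p) F z = z.
  by elim: n => // n IH; rewrite mulSn addnC iterD zp IH.
have ym : iter m F y = z.
  by rewrite /y -iterD -{1}(muln1 m) -mulnDr add1n prednK.
have yp : iter p F y = y by rewrite /y -iterD addnC iterD zp.
have ex : exists t, (0 < t)%N && `[< iter t F y = y >].
  by exists p; rewrite p0; apply/asboolP.
case: (ex_minnP ex) => tau /andP[tau0 /asboolP ytau] tau_min.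
exists tau; split=> //; exists y.
  split=> // t /andP[t0 tt] yt.
  have := tau_min t; rewrite t0 /= leqNgt tt => h.
  by have : false by apply: h; apply/asboolP.
rewrite -(cvg_shiftn m); apply: cvg_trans cv.
by apply: near_eq_cvg; apply: nearW => k /=; rewrite (addnC m) [iter _ F y]iterD ym.
Qed.

(** * Asymptotic periodicity of networks with generic thresholds *)

Lemma edist_scale (R : realType) (I : finType) (x y x' y' : cube R I) (c : R) :
  0 <= c -> (forall i, x i - y i = c * (x' i - y' i)) ->
  Defs.edist x y = c * Defs.edist x' y'.
Proof.
move=> c0 xy; rewrite /Defs.edist -[in RHS](ger0_norm c0) -sqrtr_sqr.
rewrite -sqrtrM ?sqr_ge0//.
by congr Num.sqrt; rewrite mulr_sumr; apply: eq_bigr => i _; rewrite xy exprMn.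
Qed.

Section network_dynamics.
Context (R : realType) (V : finType).

Definition arc_src (A : {set V * V}) (e : arcs A) : V := (val e).1.

Definition arc_drive (A : {set V * V}) (th : signs A) (v : V) : R :=
  (indeg A v)%:R^-1 * \sum_(e : arcs A | (val e).2 == v) (th e)%:R.

Lemma net_driveE (H0 : bool) (N : network R V) (x : V -> R) v :
  net_drive H0 N x v =
  arc_drive (firing (@arc_src _) (net_sign N) H0 (net_thr N) x) v.
Proof.
congr (_ * _); apply: eq_bigr => e _.
by rewrite ffunE heaviside_gate.
Qed.

(** Every pattern [th] is fired at the point with all coordinates [1 / 2] by a
    network with thresholds [0] and [1], so this is an instance of the bounds on
    the drive of a network. *)
Lemma arc_drive_itv (A : {set V * V}) (th : signs A) (v : V) :
  0 <= arc_drive th v <= 1.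
Proof.
have T01 (e : arcs A) : 0 <= ((~~ th e)%:R : R) <= 1.
  by case: (th e); rewrite /= lexx ler01.
have := net_drive_itv true (Network [ffun=> false] (Cube T01)) (fun=> 2^-1) v.
rewrite net_driveE (_ : firing _ _ _ _ _ = th)//.
apply/ffunP => e; rewrite !ffunE /gate /= expr0 mul1r.
have h0 : (0 : R) < 2^-1 by rewrite invr_gt0.
case: (th e) => /=; first by rewrite subr0 h0.
by case: ltrgt0P => //; lra.
Qed.

Context (H0 : bool) (a : R) (ha : 0 <= a < 1).

Lemma iter_network_map (N : network R V) (x : cube R V) t :
  iter t (network_map H0 ha N) x =
  trajectory (@arc_src _) (net_sign N) (@arc_drive _) H0 a (net_thr N) x t :> (V -> R).
Proof.
elim: t => //= t IH; apply/funext => v /=.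
by rewrite -/(trajectory _ _ _ _ _ _ _ t) /step net_driveE IH.
Qed.

Lemma generic_thresholds_asymptotic (N : network R V) (x : cube R V) :
  (forall e : arcs (net_arcs N), ~ critical (@arc_src _) (net_sign N)
     (@arc_drive _) H0 a (arc_src e) (net_thr N e)) ->
  asymptotic_period (network_map H0 ha N) x <> None.
Proof.
move=> generic.
have x01 : unit_cube x by exact: cube_itv.
have [n [d [d0 sep]]] := trajectory_separated ha (@arc_drive_itv _) x01
  (cube_itv (net_thr N)) generic.
have [m [p [z [p0 z01 zp shadow]]]] :=
  separated_trajectory_asymptotically_periodic ha
  (@arc_drive_itv _) x01 d0 sep.
have : exists tau, has_asymptotic_period (network_map H0 ha N) x tau.
  apply: (@eventually_periodic_asymptotic _ _ _ x (Cube z01) m p) => //.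
    by apply/cube_val_inj; rewrite iter_network_map; apply/funext => v; exact: zp.
  pose y : cube R V := iter m (network_map H0 ha N) x.
  have -> : (fun k => Defs.edist (iter (m + k) (network_map H0 ha N) x)
      (iter k (network_map H0 ha N) (Cube z01))) =
      (fun k => Defs.edist y (Cube z01) * a ^+ k).
    apply/funext => k; rewrite mulrC; apply: edist_scale => [|v].
      by case/andP: ha => a0 _; exact: exprn_ge0.
    by rewrite /y !iter_network_map /= -[LHS]opprB shadow -mulrN opprB.
  have : (fun k => Defs.edist y (Cube z01) * a ^+ k) @ \oo -->
      Defs.edist y (Cube z01) * (0 : R).
    by apply: cvgMr; apply: cvg_expr; case/andP: ha => a0 a1; rewrite ger0_norm.
  by rewrite mulr0.
by rewrite /asymptotic_period; case: pselect.
Qed.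

(** The right-hand side is defined for all words [w], in the cube or not, and so
    enumerates all periodic points by a countable type. *)
Lemma periodic_point_get (N : network R V) (y : cube R V) tau :
  (0 < tau)%N -> iter tau (network_map H0 ha N) y = y ->
  exists w : seq (signs (net_arcs N)), y = get [set z : cube R V |
    forall v, z v = offset (@arc_drive _) a w v / (1 - a ^+ size w)].
Proof.
move=> tau0 yp.
pose w := history (@arc_src _) (net_sign N) (@arc_drive _) H0 a (net_thr N) y tau.
exists w; set Y := [set z | _].
have Yy : Y y.
  move=> v; rewrite size_history; apply: periodic_point_offset => // u.
  by rewrite -iter_network_map yp.
apply/cube_val_inj/funext => v; rewrite Yy.
by have /= -> : Y (get Y) by exact: getI Yy.
Qed.

End network_dynamics.

(** * Measurability of the asymptotic period *)

Section network_measurability.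
Context (R : realType) (V : finType) (H0 : bool) (a : R) (ha : 0 <= a < 1).

(** A measurable left inverse of [Network s], for all [s] at once. *)
Definition restrict_thr (A : {set V * V}) (N : network R V) : cube R (arcs A) :=
  if net_arcs N =P A is ReflectT e then ecast B (cube R (arcs B)) e (net_thr N)
  else point.

Lemma restrict_thrK (A : {set V * V}) (s : signs A) (T : cube R (arcs A)) :
  @restrict_thr A (Network s T) = T.
Proof. by rewrite /restrict_thr; case: eqP => //= e; rewrite eq_axiomK. Qed.

Lemma measurable_restrict_thr (A : {set V * V}) :
  measurable_fun setT (@restrict_thr A).
Proof.
move=> _ Y mY; rewrite setTI.
suff : network_measurable (@restrict_thr A @^-1` Y) by [].
move=> B s.
have [BA|BA] := eqVneq B A.
  subst B; rewrite (_ : _ @^-1` _ = Y)//.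
  by apply/seteqP; split=> T /=; rewrite restrict_thrK.
have E T : @restrict_thr A (Network s T : network R V) = point.
  by rewrite /restrict_thr /=; case: eqP => // e; rewrite e eqxx in BA.
have [Yp|Yp] := pselect (Y point).
  rewrite (_ : _ @^-1` _ = setT)//.
  by apply/seteqP; split=> T //= _; rewrite E.
rewrite (_ : _ @^-1` _ = set0)//.
by rewrite -subset0 => T /=; rewrite E.
Qed.

(** The countably many pieces of given arcs and signs are measurable, and on each
    of them [f] factors through [restrict_thr]. *)
Lemma measurable_fun_network d (U : measurableType d)
    (f : network R V * cube R V -> U) :
  (forall (A : {set V * V}) (s : signs A), measurable_fun setT
    (fun q : cube R (arcs A) * cube R V => f (Network s q.1, q.2))) ->
  measurable_fun setT f.
Proof.
move=> mf _ Y mY; rewrite setTI.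
pose C (i : {A : {set V * V} & signs A}) : set (network R V * cube R V) :=
  [set (Network (projT2 i) T, x) | T in box (fun=> `]-oo, +oo[) &
                                   x in box (fun=> `]-oo, +oo[)].
pose r (i : {A : {set V * V} & signs A}) (p : network R V * cube R V) :=
  (restrict_thr (projT1 i) p.1, p.2).
pose D (i : {A : {set V * V} & signs A}) :
    set (cube R (arcs (projT1 i)) * cube R V) :=
  [set q | Y (f (Network (projT2 i) q.1, q.2))].
have -> : f @^-1` Y = \bigcup_i (C i `&` r i @^-1` D i).
  apply/seteqP; split=> [[[A s T] x] Yf|p [[A s] _ [[T _ [x _ <-]]]]].
    exists (existT _ A s) => //; split.
      by exists T; [|exists x] => // i; rewrite in_itv.
    by rewrite /r /D /= restrict_thrK.
  by rewrite /r /D /= restrict_thrK.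
apply: countable_bigcupT_measurable => [|[A s]]; first exact: countableP.
apply: measurableI; first exact: measurable_network_box.
have mr : measurable_fun setT (r (existT _ A s)).
  apply: measurable_fun_pair => //.
  exact: (measurableT_comp (@measurable_restrict_thr A) measurable_fst).
rewrite -[X in measurable X]setTI; apply: mr => //.
have := mf A s measurableT Y mY; rewrite setTI; exact.
Qed.

Lemma measurable_heaviside : measurable_fun setT (@heaviside R H0).
Proof.
apply: measurable_fun_ifT => //; first exact: measurable_fun_ltr.
by apply: measurable_fun_ifT => //; exact: measurable_fun_ltr.
Qed.

Lemma measurable_network_map : measurable_fun setT
  (fun p : network R V * cube R V => network_map H0 ha p.1 p.2).
Proof.
apply: measurable_fun_network => A s; apply: measurable_fun_cube => v /=.
apply: measurable_funD.
  apply: measurable_funM => //; exact: (measurableT_comp (measurable_cube_coord v)).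
apply: measurable_funM => //; apply: measurable_funM => //=.
under eq_fun do rewrite big_mkcond.
apply: measurable_sum => e; case: ((val e).2 == v) => //.
apply: (measurableT_comp measurable_heaviside); apply: measurable_funM => //.
apply: measurable_funB.
  exact: (measurableT_comp (measurable_cube_coord _)).
exact: (measurableT_comp (measurable_cube_coord _)).
Qed.

Lemma measurable_iter_network_map t d (U : measurableType d)
    (f : U -> network R V) (g : U -> cube R V) :
  measurable_fun setT f -> measurable_fun setT g ->
  measurable_fun setT (fun u => iter t (network_map H0 ha (f u)) (g u)).
Proof.
move=> mf mg; elim: t => //= t IH.
exact: (measurableT_comp measurable_network_map (measurable_fun_pair mf IH)).
Qed.

Lemma measurable_edist d (U : measurableType d) (f g : U -> cube R V) :
  measurable_fun setT f -> measurable_fun setT g ->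
  measurable_fun setT (fun u => Defs.edist (f u) (g u)).
Proof.
move=> mf mg.
apply: (measurableT_comp (continuous_measurable_fun (@sqrt_continuous R))).
apply: measurable_sum => v; apply: measurable_funX; apply: measurable_funB.
  exact: (measurableT_comp (measurable_cube_coord v)).
exact: (measurableT_comp (measurable_cube_coord v)).
Qed.

Lemma measurable_cvg0 d (U : measurableType d) (f : nat -> U -> R) :
  (forall n, measurable_fun setT (f n)) ->
  measurable [set u | f ^~ u @ \oo --> (0 : R)].
Proof.
move=> mf.
have -> : [set u | f ^~ u @ \oo --> (0 : R)] =
    \bigcap_k \bigcup_n \bigcap_(t in [set t | (n <= t)%N])
      (fun u => `|f t u|) @^-1` [set` `]-oo, k.+1%:R^-1[].
  apply/seteqP; split=> u /=.
    move=> /cvgrPdist_lt h k _.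
    have [|n _ nP] := h k.+1%:R^-1; first by rewrite invr_gt0.
    by exists n => // t nt; have := nP t nt; rewrite /= in_itv /= sub0r normrN.
  move=> h; apply/cvgrPdist_lt => e e0.
  have [k ke] : exists k : nat, k.+1%:R^-1 < e.
    exists (Num.truncn e^-1); rewrite invf_plt ?posrE//; exact: truncnS_gt.
  have [n _ nP] := h k I; exists n => // t nt.
  by have := nP t nt; rewrite /= in_itv /= sub0r normrN => /lt_trans; apply.
apply: bigcapT_measurable => k; apply: bigcupT_measurable => n.
apply: bigcap_measurableType => // t _.
rewrite -[X in measurable X]setTI; apply: measurableT_comp => //.
Qed.

Lemma measurable_cube_eq d (U : measurableType d) (f : U -> cube R V) y :
  measurable_fun setT f -> measurable [set u | f u = y].
Proof.
move=> mf.
rewrite (_ : [set u | _] = f @^-1` box (fun v => `[y v, y v])); last first.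
  apply/seteqP; split=> u /= => [->|h].
    by move=> v; rewrite in_itv /= lexx.
  apply/cube_val_inj/funext => v; have := h v; rewrite in_itv /= -eq_le.
  by move/eqP.
rewrite -[X in measurable X]setTI; apply: mf => //; exact: measurable_box.
Qed.

(** The attracting periodic point, a priori an arbitrary one, may be taken in the
    countable family of [periodic_point_get], whose members do not depend on the
    sample. *)
Lemma measurable_has_asymptotic_period tau : measurable
  [set p : network R V * cube R V |
    has_asymptotic_period (network_map H0 ha p.1) p.2 tau].
Proof.
case: tau => [|tau].
  by rewrite (_ : [set _ | _] = set0)// -subset0 => p [].
pose y (i : {A : {set V * V} & seq (signs A)}) : cube R V :=
  get [set z : cube R V | forall v, z v =
    offset (@arc_drive R V _) a (projT2 i) v / (1 - a ^+ size (projT2 i))].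
pose F (p : network R V * cube R V) := network_map H0 ha p.1.
have -> : [set p | has_asymptotic_period (F p) p.2 tau.+1] = \bigcup_i
    ([set p | iter tau.+1 (F p) (y i) = y i] `&`
     (\bigcap_(t in [set t | (1 <= t < tau.+1)%N])
        ~` [set p | iter t (F p) (y i) = y i]) `&`
     [set p | (fun t => Defs.edist (iter t (F p) p.2) (iter t (F p) (y i)))
                @ \oo --> (0 : R)]).
  apply/seteqP; split=> p.
    move=> [_ [z [zp zmin] cv]].
    have [w wz] := periodic_point_get (ltn0Sn tau) zp.
    exists (existT (fun B : {set V * V} => seq (signs B)) _ w) => //.
    by rewrite /y /= -wz; split.
  by move=> [i _ [[yp ymin] cv]]; split=> //; exists (y i).
have m1 : measurable_fun setT (fst : network R V * cube R V -> _) by [].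
have m2 : measurable_fun setT (snd : network R V * cube R V -> _) by [].
apply: countable_bigcupT_measurable => [|i]; first exact: countableP.
apply: measurableI; first apply: measurableI.
- by apply: measurable_cube_eq; exact: measurable_iter_network_map.
- apply: bigcap_measurableType => // t _; apply: measurableC.
  by apply: measurable_cube_eq; exact: measurable_iter_network_map.
- apply: measurable_cvg0 => t.
  by apply: measurable_edist; exact: measurable_iter_network_map.
Qed.

Lemma measurable_asymptotic_period : measurable_fun setT
  (fun p : network R V * cube R V => asymptotic_period (network_map H0 ha p.1) p.2).
Proof.
move=> _ Y _; rewrite setTI; set P := fun p => _.
have mS o : measurable (P @^-1` [set o]).
  case: o => [tau| ].
    rewrite (_ : _ @^-1` _ = [set p |
        has_asymptotic_period (network_map H0 ha p.1) p.2 tau]).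
      exact: measurable_has_asymptotic_period.
    by apply/seteqP; split=> p /= /asymptotic_periodP.
  rewrite (_ : _ @^-1` _ = ~` \bigcup_tau
      [set p | has_asymptotic_period (network_map H0 ha p.1) p.2 tau]).
    by apply: measurableC; apply: bigcupT_measurable => tau;
      exact: measurable_has_asymptotic_period.
  apply/seteqP; split=> p /=.
    by move=> pN [tau _ /asymptotic_periodP]; rewrite -/(P p) pN.
  case E : (P p) => [tau|] // h; exfalso; apply: h; exists tau => //.
  exact/asymptotic_periodP.
rewrite (_ : P @^-1` Y = \bigcup_o (if `[< Y o >] then P @^-1` [set o] else set0)).
  apply: countable_bigcupT_measurable => [|o]; first exact: countableP.
  by case: ifP => _; [exact: mS|exact: measurable0].
apply/seteqP; split=> [p Yp|p [b _]].
  by exists (P p) => //; rewrite (asboolT Yp).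
by case: asboolP => // Yb Pb; rewrite /= Pb.
Qed.

End network_measurability.

(** * Critical thresholds have probability zero *)

Lemma negligible_countable_bigcup d (U : measurableType d) (R : realType)
    (mu : {measure set U -> \bar R}) (I : countType) (F : I -> set U) :
  (forall i, mu.-negligible (F i)) -> mu.-negligible (\bigcup_i F i).
Proof.
move=> nF; pose G n := if unpickle n is Some i then F i else set0.
apply: (@negligibleS _ _ _ _ (\bigcup_n G n)).
  by move=> u [i _ Fu]; exists (pickle i) => //; rewrite /G pickleK.
apply: negligible_bigcup => n; rewrite /G.
by case: unpickle => [i|]; [exact: nF|exact: negligible_set0].
Qed.

Definition critical_arc (R : realType) (V : finType) (H0 : bool) (a : R)
    (i : {A : {set V * V} & (signs A * arcs A)%type}) :
    set (network R V * cube R V) :=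
  let: existT A (s, e) := i in
  [set (Network s T, x) | T in [set T : cube R (arcs A) |
     critical (@arc_src V A) s (@arc_drive R V A) H0 a (arc_src e) (T e)] &
   x in [set: cube R V]].

Section critical_arc_probability.
Context (R : realType) (V : finType) (PG : {set V * V} -> R) (eta : R).
Context (P : probability (network R V * cube R V)%type R).
Hypothesis PG_ge0 : forall A, 0 <= PG A.
Hypothesis heta : 0 <= eta <= 1.
Hypothesis lawP : is_network_law PG eta P.

(** A threshold confined to an interval of length [l] is a rectangle event, whose
    probability is prescribed by the law. *)
Lemma threshold_band_prob (A : {set V * V}) (s : signs A) (e : arcs A) (r l : R) :
  0 <= r -> 0 <= l ->
  exists2 B, measurable B &
    [set (Network s T, x) | T in [set T : cube R (arcs A) | r <= T e <= r + l] &
                            x in [set: cube R V]] `<=` B /\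
    (P B <= (PG A * sign_prob eta s * l)%:E)%E.
Proof.
move=> r0 l0.
pose J := fun _ : V => (`[0, 1] : interval R).
pose I := fun e' : arcs A =>
  (if e' == e then `[r, Num.min 1 (r + l)] else `[0, 1]) : interval R.
exists [set (Network s T, x) | T in box I & x in box J].
  exact: measurable_network_box.
split.
  move=> _ [T /= /andP[Tr Tl] [x _ <-]]; exists T; [|exists x] => //.
    move=> e'; rewrite /I; case: eqP => [->|_].
      by rewrite in_itv /= Tr le_min Tl andbT; case/andP: (cube_itv T e).
    by rewrite in_itv /=; exact: cube_itv.
  by move=> v; rewrite in_itv /=; exact: cube_itv.
have mu01 : lebesgue_measure [set` (`[0, 1] : interval R)] = 1%:E.
  by rewrite lebesgue_measure_itv /= lte_fin ltr01 sube0.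
have I01 e' : [set` I e'] `<=` `[0, 1].
  rewrite /I; case: eqP => _ t //=; rewrite !in_itv /= => /andP[rt].
  by rewrite le_min => /andP[t1 _]; rewrite (le_trans r0 rt).
have J01 v : [set` J v] `<=` `[0, 1] by [].
rewrite (lawP s I01 J01).
have -> : box_vol J = 1%:E by rewrite /box_vol big1.
rewrite mule1 /box_vol (bigD1 e)//=.
rewrite [X in (_ * (_ * X))%E]big1 => [|e' e'e]; last first.
  by rewrite /I (negbTE e'e).
rewrite mule1 [X in (_ <= X)%E]EFinM lee_wpmul2l//.
  by rewrite lee_fin mulr_ge0// sign_prob_ge0.
rewrite /I eqxx lebesgue_measure_itv /=; case: ifP => _; last by rewrite lee_fin.
by rewrite -EFinB lee_fin lerBlDl ge_min lexx orbT.
Qed.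

(** The critical levels do not depend on the thresholds, so for each [t] the
    event that [T e] is critical is covered by the rectangle events that [T e] is
    in one of the bands of time [t].  Their probabilities add up to at most a
    constant times the number of histories times [a ^+ t]. *)
Lemma critical_arc_negligible (H0 : bool) (a : R) (ha : 0 <= a < 1)
    (i : {A : {set V * V} & (signs A * arcs A)%type}) :
  P.-negligible (critical_arc H0 a i).
Proof.
case: i => A [s e].
set Z := critical_arc _ _ _.
pose c := PG A * sign_prob eta s.
have c0 : 0 <= c by rewrite mulr_ge0// sign_prob_ge0.
have cover eps : 0 < eps -> exists2 B, measurable B & Z `<=` B /\ (P B <= eps%:E)%E.
  move=> eps0.
  (* c + 1 rather than c, which vanishes for graphs of probability 0. *)
  have eps1 : 0 < eps / (c + 1) by rewrite divr_gt0// ltr_wpDl.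
  have [t [S [St SP]]] := history_subexponential (@arc_src V A) s H0 ha
    (@arc_drive_itv R V A) eps1.
  have a0 : 0 <= a ^+ t by case/andP: ha => a0 _; exact: exprn_ge0.
  have /choice[B BP] : forall w : seq (signs A),
      exists B : set (network R V * cube R V),
     [/\ measurable B, [set (Network s T, x) | T in [set T : cube R (arcs A) |
       offset (@arc_drive R _ _) a w (arc_src e) <= T e <=
       offset (@arc_drive R _ _) a w (arc_src e) + a ^+ t] & x in [set: cube R V]] `<=` B
     & (P B <= (c * a ^+ t)%:E)%E].
    move=> w; have /andP[f0 _] := offset_itv ha (@arc_drive_itv R V A) w (arc_src e).
    by have [B mB [ZB PB]] := threshold_band_prob s e f0 a0; exists B; split.
  exists (\big[setU/set0]_(k < size S) B (nth [::] S k)).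
    by apply: bigsetU_measurable => k _; have [] := BP (nth [::] S k).
  split.
    move=> _ [T TZ [x _ <-]]; have [w wS wT] := TZ t S SP.
    rewrite -(bigcup_mkord (size S) (fun k => B (nth [::] S k))).
    exists (index w S) => /=; first by rewrite index_mem.
    by rewrite nth_index//; have [_ h _] := BP w; apply: h; exists T => //; exists x.
  have mB k : measurable (B (nth [::] S k)) by have [] := BP (nth [::] S k).
  apply: (@le_trans _ _ (\sum_(k < size S) P (B (nth [::] S k)))%E).
    by apply: (@Boole_inequality _ _ _ P (fun k => B (nth [::] S k))) => k _.
  apply: (@le_trans _ _ (\sum_(k < size S) (c * a ^+ t)%:E)%E).
    by apply: lee_sum => k _; have [] := BP (nth [::] S k).
  rewrite sumEFin lee_fin sumr_const card_ord -mulr_natl mulrCA.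
  have : c * ((size S)%:R * a ^+ t) <= c * (eps / (c + 1)).
    by rewrite ler_wpM2l// ltW.
  move/le_trans; apply.
  by rewrite mulrCA ler_piMr ?(ltW eps0)// ler_pdivrMr ?ltr_wpDl// mul1r lerDl.
have /choice[B BP] : forall n : nat, exists B, [/\ measurable B, Z `<=` B &
    (P B <= (n.+1%:R^-1)%:E)%E].
  by move=> n; have [|B mB [ZB PB]] := cover n.+1%:R^-1;
    [rewrite invr_gt0|exists B; split].
exists (\bigcap_n B n); split.
- by apply: bigcapT_measurable => n; have [] := BP n.
- apply/eqP; rewrite eq_le measure_ge0 andbT.
  apply/lee_addgt0Pr => eps eps0; rewrite add0e.
  have [n ne] : exists n : nat, n.+1%:R^-1 < eps.
    exists (Num.truncn eps^-1); rewrite invf_plt ?posrE//; exact: truncnS_gt.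
  have [mB _ PB] := BP n; apply: (@le_trans _ _ (P (B n))).
    apply: le_measure; rewrite ?inE//; last exact: bigcap_inf.
    by apply: bigcapT_measurable => k; have [] := BP k.
  by apply: (le_trans PB); rewrite lee_fin ltW.
- by move=> p Zp n _; have [_ h _] := BP n; exact: h.
Qed.

End critical_arc_probability.

Theorem theorem1 (R : realType) (V : finType) (H0 : bool) (a : R)
    (ha : 0 <= a < 1) :
  measurable_fun setT
    (fun p : network R V * cube R V =>
       asymptotic_period (network_map H0 ha p.1) p.2)
  /\
  forall (PG : {set V * V} -> R) (PG_ge0 : forall A, 0 <= PG A)
    (PG_sum1 : \sum_A PG A = 1) (eta : R) (heta : 0 <= eta <= 1)
    (P : probability (network R V * cube R V)%type R),
    is_network_law PG eta P ->
    P [set p | asymptotic_period (network_map H0 ha p.1) p.2 <> None] = 1%E.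
Proof.
have mper := @measurable_asymptotic_period R V H0 a ha.
split=> // PG PG_ge0 _ eta heta P lawP.
set Q := [set p | _].
have mQC : measurable (~` Q).
  rewrite (_ : ~` Q = (fun p : network R V * cube R V =>
       asymptotic_period (network_map H0 ha p.1) p.2) @^-1` [set None]).
    by rewrite -[X in measurable X]setTI; apply: mper.
  by apply/seteqP; split=> p; rewrite /Q /=; [move/contrapT|move=> ->; apply].
suff QC0 : P (~` Q) = 0%E.
  by rewrite -[Q]setCK probability_setC// QC0 sube0.
apply/negligibleP => //.
apply: (@negligibleS _ _ _ _ (\bigcup_i @critical_arc R V H0 a i)); last first.
  apply: negligible_countable_bigcup => i.
  exact (critical_arc_negligible PG_ge0 heta lawP H0 ha i).
move=> [[A s T] x]; apply: contra_notP => generic.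
apply: generic_thresholds_asymptotic => e crit; apply: generic.
exists (existT (fun B : {set V * V} => (signs B * arcs B)%type) A (s, e)) => //.
by exists T => //; exists x.
Qed.
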